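(* Let $n=2^s\ge 8$, $\zeta=e^{2\pi i/n}$, $K={\mathbf Q}(\zeta)$, $F={\mathbf Q}(\zeta+\zeta^{-1})$, $\underline{\mathcal O}={\mathbf Z}[\zeta+\zeta^{-1}]$, and $p=2+\zeta+\zeta^{-1}$, a generator of the unique prime $\mathfrak p$ of $\underline{\mathcal O}$ above $2$. Let $L$ be a totally complex quadratic extension of $F$ with ring of integers $\mathcal O_L$, and suppose $\mathfrak p\mathcal O_L$ is the square of a principal ideal. Then $L$ is either $K$ or $F(\sqrt{-p})$, and in either case any generator $q$ of the prime of $\mathcal O_L$ above $\mathfrak p$ satisfies $\mathcal O_L=\underline{\mathcal O}[q]$. *)

(* Defs.v *)
(* all number fields are subfields of algC (algebraic complex numbers). *)
From HB Require Import structures.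
From mathcomp Require Import all_boot all_order all_algebra all_field.
Set Implicit Arguments. Unset Strict Implicit. Unset Printing Implicit Defensive.
Import GRing.Theory Num.Theory.
Local Open Scope ring_scope.

(* n = 2^s ;  zeta = e^{2 pi i / n} = e^{i pi / (n/2)} = (n/2).-root (-1)
   (nthroot picks the root with nonnegative imaginary part and maximal real part) *)
Definition zeta (s : nat) : algC := (2 ^ s.-1)%N.-root (-1).
Definition theta (s : nat) : algC := zeta s + (zeta s)^-1.
Definition pgen (s : nat) : algC := 2 + theta s.

Definition same_set (A B : algC -> Prop) := forall x, A x <-> B x.
Definition subset_of (A B : algC -> Prop) := forall x, A x -> B x.

Definition Kfield (s : nat) : algC -> Prop :=
  fun x => exists P : {poly rat}, x = (map_poly ratr P).[zeta s].
Definition Ffield (s : nat) : algC -> Prop :=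
  fun x => exists P : {poly rat}, x = (map_poly ratr P).[theta s].
Definition Ounder (s : nat) : algC -> Prop :=
  fun x => exists P : {poly int}, x = (map_poly intr P).[theta s].

Definition adjoin (R : algC -> Prop) (a : algC) : algC -> Prop :=
  fun x => exists P : {poly algC}, (forall i, R P`_i) /\ x = P.[a].

Definition Fsqrt (s : nat) : algC -> Prop := adjoin (Ffield s) (sqrtC (- pgen s)).

Definition is_subfield (L : algC -> Prop) :=
  [/\ L 0, L 1, (forall x y, L x -> L y -> L (x - y)),
      (forall x y, L x -> L y -> L (x * y)) & (forall x, L x -> L x^-1)].

Definition degree2_over (F L : algC -> Prop) :=
  exists e1 e2 : algC, [/\ L e1, L e2 &
    forall x, L x -> exists! ab : algC * algC,
      [/\ F ab.1, F ab.2 & x = ab.1 * e1 + ab.2 * e2]].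

(* every embedding of L into C (each extends to a field automorphism of algC)
   has non-real image *)
Definition totally_complex (L : algC -> Prop) :=
  forall sigma : {rmorphism algC -> algC}, exists x, L x /\ sigma x \notin Num.real.

Definition ring_of_integers (L : algC -> Prop) : algC -> Prop :=
  fun x => L x /\ x \in Aint.

Definition pideal (R : algC -> Prop) (a : algC) : algC -> Prop :=
  fun x => exists r, R r /\ x = r * a.

Definition prime_ideal (R I : algC -> Prop) :=
  (exists x, R x /\ ~ I x) /\
  (forall a b, R a -> R b -> I (a * b) -> I a \/ I b).

(* Main.v *)
Require Import Defs.
From HB Require Import structures.
From mathcomp Require Import all_boot all_order all_algebra all_field.
From mathcomp Require Import ring zify.
Import Order.TTheory GRing.Theory Num.Theory.
Set Implicit Arguments. Unset Strict Implicit. Unset Printing Implicit Defensive.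
Local Open Scope ring_scope.

(** Complex conjugation preserves L and commutes with every embedding. If (p) = (q^2) in O_L, then
    w = q^* / q is an integral element of L all of whose conjugates have absolute value 1, hence a
    root of unity by Kronecker. If some power of w squares to -1 then L = K. Otherwise w = eps v^2
    with eps = 1 or -1 and v a root of unity in L, and q v is real or purely imaginary. It cannot be
    real, because p is not associate to a square in F; so - (q v)^2 / p is a totally positive unit
    of F, which is a square by Weber's theorem, and L = F(sqrt(- p)).

    Weber's theorem is reduced, Gal(F/Q) = <sigma> being a 2-group, to a unit u with
    sigma u = u eta^2. If eta has norm 1, Hilbert 90 gives u = r b^2 with r rational, and r is 1 or 2
    modulo squares since odd primes do not ramify; both are squares in F. If eta has norm -1, apply
    the same to u p, because sigma p / p is the square of a unit of norm -1; then the p-adic valuation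
    of u p is odd whereas that of a rational number is even.

    For O_L = O[q]: in both fields w has 2-power order, so q - q^* = q (1 - w) divides a power
    of 2 and O[q] contains 2^2 O_L; the denominators are then removed one factor q at a time. *)

(** * Subrings and integral closure *)

Definition is_subring (R : algC -> Prop) :=
  [/\ R 1, forall x y, R x -> R y -> R (x - y)
    & forall x y, R x -> R y -> R (x * y)].

Section Subring.
Variables (R : algC -> Prop) (hR : is_subring R).

Lemma subring1 : R 1. Proof. by case: hR. Qed.
Lemma subringB x y : R x -> R y -> R (x - y). Proof. by case: hR => _ + _; apply. Qed.
Lemma subringM x y : R x -> R y -> R (x * y). Proof. by case: hR => _ _; apply. Qed.
Lemma subring0 : R 0.
Proof. by rewrite -(subrr 1); apply: subringB; exact: subring1. Qed.
Lemma subringN x : R x -> R (- x).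
Proof. by move=> Rx; rewrite -sub0r; apply: subringB => //; exact: subring0. Qed.
Lemma subringD x y : R x -> R y -> R (x + y).
Proof. by move=> Rx Ry; rewrite -[y]opprK; apply: subringB => //; exact: subringN. Qed.
Lemma subringX x k : R x -> R (x ^+ k).
Proof.
by move=> Rx; elim: k => [|k IHk]; rewrite ?expr0 ?exprS; [exact: subring1|exact: subringM].
Qed.
Lemma subring_sum (I : Type) (r : seq I) (P : pred I) (f : I -> algC) :
  (forall i, P i -> R (f i)) -> R (\sum_(i <- r | P i) f i).
Proof. by move=> Rf; apply: big_ind => //; [exact: subring0|exact: subringD]. Qed.
Lemma subring_prod (I : Type) (r : seq I) (P : pred I) (f : I -> algC) :
  (forall i, P i -> R (f i)) -> R (\prod_(i <- r | P i) f i).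
Proof. by move=> Rf; apply: big_ind => //; [exact: subring1|exact: subringM]. Qed.
Lemma subringMn x k : R x -> R (x *+ k).
Proof.
by move=> Rx; elim: k => [|k IHk]; rewrite ?mulr0n ?mulrS; [exact: subring0|exact: subringD].
Qed.
Lemma subring_nat k : R k%:R. Proof. exact/subringMn/subring1. Qed.
Lemma subring_int (k : int) : R k%:~R.
Proof.
by case: k => k; rewrite ?NegzE ?rmorphN; [|apply: subringN]; exact: subring_nat.
Qed.
Lemma subring_horner (P : {poly algC}) a : (forall i, R P`_i) -> R a -> R P.[a].
Proof.
move=> RP Ra; rewrite horner_coef; apply: subring_sum => i _.
by apply: subringM => //; exact: subringX.
Qed.
(* [x^-1] is a rational polynomial in [x]: divide the minimal polynomial of [x] by its constant term. *)
Lemma subring_inv x : (forall a : rat, R (ratr a)) -> R x -> R x^-1.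
Proof.
move=> Rrat Rx; have [-> | nzx] := eqVneq x 0; first by rewrite invr0; exact: subring0.
have [p [Dp monp] minp] := minCpolyP x.
have := root_minCpoly x; rewrite Dp => px.
(* With a zero constant term, a factor [X] could be cancelled, against the minimality of [p]. *)
case: (eqVneq (p`_0) 0) => [p0 | nzp0].
  have [g Dg] : exists g, p = g * 'X.
    have /factor_theorem[g ->] : root p 0 by rewrite rootE horner_coef0 p0.
    by exists g; rewrite subr0.
  have : root (map_poly ratr g : {poly algC}) x.
    move: px; rewrite Dg rmorphM /= map_polyX rootM => /orP[] //.
    by rewrite rootX (negPf nzx).
  have nzg : g != 0.
    by apply: contraTneq monp => g0; rewrite Dg g0 mul0r monicE lead_coef0 eq_sym oner_eq0.
  by rewrite minp => /(dvdp_leq nzg); rewrite Dg size_mulX // ltnn.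
pose g := p - (p`_0)%:P.
have [g' Dg] : exists g', g = g' * 'X.
  have /factor_theorem[g' ->] : root g 0 by rewrite rootE horner_coef0 coefB coefC subrr.
  by exists g'; rewrite subr0.
have E : (map_poly ratr g').[x] * x = - ratr p`_0 :> algC.
  have : (map_poly ratr p).[x] = 0 :> algC by apply/eqP.
  have -> : p = g' * 'X + (p`_0)%:P by rewrite -Dg /g subrK.
  rewrite rmorphD rmorphM /= map_polyX map_polyC /= !hornerE.
  by move/eqP; rewrite addr_eq0 => /eqP ->; congr (- ratr _); rewrite coefD coefMX coefC /= add0r.
have -> : x^-1 = - (map_poly ratr g').[x] * ratr (p`_0)^-1.
  rewrite fmorphV /=; have nzr : ratr p`_0 != 0 :> algC by rewrite fmorph_eq0.
  apply: (mulIf nzx); rewrite mulVf //.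
  by rewrite mulrAC mulNr E opprK divff.
apply: subringM => //; apply: subringN; apply: subring_horner => //.
by move=> i; rewrite coef_map /=; exact: Rrat.
Qed.
End Subring.

(** [Kfield], [Ffield] and [Ounder] are instances by conversion, with [A] the rationals or the
    integers, so that ring properties are proved once. *)
Definition polyimage (A : nzRingType) (f : {rmorphism A -> algC}) (a : algC) x :=
  exists P : {poly A}, x = (map_poly f P).[a].

Lemma polyimage_subring (A : nzRingType) (f : {rmorphism A -> algC}) a :
  is_subring (polyimage f a).
Proof.
split; first by exists 1; rewrite rmorph1 hornerC.
  by move=> _ _ [P ->] [Q ->]; exists (P - Q); rewrite rmorphB !hornerE.
by move=> _ _ [P ->] [Q ->]; exists (P * Q); rewrite rmorphM /= hornerM.
Qed.

Lemma polyimageC (A : nzRingType) (f : {rmorphism A -> algC}) a c : polyimage f a (f c).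
Proof. by exists c%:P; rewrite map_polyC hornerC. Qed.

Lemma polyimageX (A : nzRingType) (f : {rmorphism A -> algC}) a : polyimage f a a.
Proof. by exists 'X; rewrite map_polyX hornerX. Qed.

Lemma sub_polyimage (A : nzRingType) (f : {rmorphism A -> algC}) a (R : algC -> Prop) :
  is_subring R -> (forall c, R (f c)) -> R a -> forall x, polyimage f a x -> R x.
Proof.
by move=> hR Rf Ra _ [P ->]; apply: subring_horner => // i; rewrite coef_map; exact: Rf.
Qed.

Lemma Aint_subringP : is_subring (fun x => x \in Aint).
Proof. by split=> [|x y|x y]; rewrite ?rpred1 //; [exact: rpredB|exact: rpredM]. Qed.

(** The minimal polynomial of [x ^+ k], composed with [X^k], is monic and integral and vanishes at
    [x]. *)
Lemma Aint_root k (x : algC) : (0 < k)%N -> x ^+ k \in Aint -> x \in Aint.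
Proof.
move=> k0 Ax; pose p : {poly algC} := minCpoly (x ^+ k) \Po 'X^k.
have monm := minCpoly_monic (x ^+ k).
apply: (@root_monic_Aint p).
- by rewrite rootE horner_comp hornerXn; exact: root_minCpoly.
- by rewrite monicE lead_coef_comp ?size_polyXn // (monicP monm) mul1r lead_coefXn expr1n.
- have /floorpP[pz Dp] : minCpoly (x ^+ k) \is a polyOver Num.int by [].
  have -> : p = map_poly intr (pz \Po 'X^k) by rewrite /p Dp map_comp_poly map_polyXn.
  by apply/polyOverP => i; rewrite coef_map /= rpred_int.
Qed.

Lemma half_notin_Aint : (2%:R^-1 : algC) \notin Aint.
Proof.
apply/negP => /Cint_rat_Aint; rewrite rpredV rpred_nat => /(_ isT).
have: (2 %| 1)%C = false by rewrite -[1]/(1%:R) (dvdC_nat 2 1).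
by rewrite unfold_in /= pnatr_eq0 /= mul1r => ->.
Qed.

Lemma int_parity (c : int) : exists c', c = c' * 2 \/ c = c' * 2 + 1.
Proof.
by exists (c %/ 2)%Z; have := divz_eq c 2; have := ltz_pmod c (erefl : 0 < 2 :> int);
  have := modz_ge0 c (erefl : 2 != 0 :> int); lia.
Qed.

(* Integral closedness at the prime [p]: a quotient [x] with [2^N x] in [R] can be brought
   back into [R] by removing one factor [p] of the denominator at a time. *)
Lemma integral_descent (R : algC -> Prop) (p x : algC) k N :
  is_subring R -> (forall x, R x -> x \in Aint) -> R p ->
  (exists2 u, R u & 2 = p * u) -> (exists2 u, R u & p ^+ k = 2 * u) ->
  (forall x, R x -> exists2 c : int, True & exists2 r, R r & x = c%:~R + p * r) ->
  x \in Aint -> R (2 ^+ N * x) -> R x.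
Proof.
move=> hR RA Rp [u Ru Du] [v Rv Dv] Rmod Ax.
have nz2 : 2 != 0 :> algC by rewrite pnatr_eq0.
have nzp : p != 0 by apply: contra_neq nz2 => p0; rewrite Du p0 mul0r.
(* Otherwise [1/2 = p^-k v] would be integral. *)
have pnu : p^-1 \notin Aint.
  apply: contra half_notin_Aint => Ap.
  have -> : 2^-1 = p^-1 ^+ k * v; last by rewrite rpredM ?rpredX //; apply: RA.
  apply: (mulfI nz2); rewrite mulfV // mulrCA -Dv exprVn mulVf //.
  by rewrite expf_neq0.
have E2 : (2 : int)%:~R = 2 :> algC by [].
(* Modulo [p], the element [p y] is an integer [c]. If [c] is even, [p] divides it through 2; an odd
   [c] would make [p] invertible. *)
have step y : y \in Aint -> R (p * y) -> R y.
  move=> Ay /Rmod[c _ [r Rr Dr]].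
  have Dc : c%:~R = p * (y - r) by rewrite mulrBr Dr addrK.
  have [c' [Dc'|Dc']] := int_parity c.
  - have -> : y = c'%:~R * u + r.
      apply: (mulfI nzp); rewrite Dr Dc' intrM E2 {1}Du; ring.
    by apply: subringD => //; apply: subringM => //; exact: subring_int.
  - case/negP: pnu; have -> : p^-1 = y - r - c'%:~R * u.
      apply: (mulfI nzp); rewrite divff // !mulrBr mulrCA -Du -mulrBr -Dc Dc' intrD intrM E2; ring.
    by rewrite !rpredB // ?rpredM ?Aint_int //; apply: RA.
have steps M y : y \in Aint -> R (p ^+ M * y) -> R y.
  elim: M y => [|M IH] y Ay; first by rewrite mul1r.
  by rewrite exprSr -mulrA => /IH/step; apply => //; rewrite rpredM //; apply: RA.
(* Since 2 divides [p ^+ k], the denominator [2 ^+ N] may be replaced by [p ^+ (k * N)]. *)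
move=> RNx; apply: (steps (k * N)%N) => //.
by rewrite exprM Dv exprMn mulrAC; apply: subringM => //; exact: subringX.
Qed.

(** Elements congruent to an integer modulo [p] form a ring, so the residue hypothesis of
    [integral_descent] need only be checked on generators. *)
Lemma residue_subring (R : algC -> Prop) (p : algC) : is_subring R -> R p ->
  is_subring (fun x => exists2 c : int, True & exists2 r, R r & x = c%:~R + p * r).
Proof.
move=> hR Rp; split; first by exists 1 => //; exists 0; [exact: subring0 | rewrite mulr0 addr0].
  move=> _ _ [c _ [r Or ->]] [d _ [t Ot ->]]; exists (c - d) => //.
  by exists (r - t); [exact: subringB | rewrite rmorphB /=; ring].
move=> _ _ [c _ [r Or ->]] [d _ [t Ot ->]]; exists (c * d) => //.
exists (c%:~R * t + r * d%:~R + p * r * t); last by rewrite rmorphM /=; ring.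
have hc := subring_int hR c; have hd := subring_int hR d.
by apply: subringD => //; [apply: subringD => //; apply: subringM => //
  | apply: subringM => //; apply: subringM => //].
Qed.

Lemma adjoin_subring (R : algC -> Prop) a : is_subring R -> is_subring (adjoin R a).
Proof.
move=> hR; split.
- exists 1; split=> [i|]; last by rewrite hornerC.
  by rewrite coef1; exact: subring_nat.
- move=> _ _ [P [hP ->]] [Q [hQ ->]]; exists (P - Q); rewrite !hornerE; split=> // i.
  by rewrite coefB; exact: subringB.
- move=> _ _ [P [hP ->]] [Q [hQ ->]]; exists (P * Q); rewrite !hornerE; split=> // i.
  by rewrite coefM; apply: subring_sum => // j _; exact: subringM.
Qed.

Lemma adjoin_const (R : algC -> Prop) a c : is_subring R -> R c -> adjoin R a c.
Proof.
move=> hR Rc; exists c%:P; rewrite hornerC; split=> // i; rewrite coefC.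
by case: ifP => // _; exact: subring0.
Qed.

Lemma adjoin_gen (R : algC -> Prop) a : is_subring R -> adjoin R a a.
Proof.
move=> hR; exists 'X; rewrite hornerX; split=> // i.
by rewrite coefX; exact: subring_nat.
Qed.

Lemma sub_adjoin (R S : algC -> Prop) a : is_subring S -> (forall x, R x -> S x) -> S a ->
  forall x, adjoin R a x -> S x.
Proof. by move=> hS RS Sa _ [P [hP ->]]; apply: subring_horner => // i; apply: RS. Qed.

(** * The cyclotomic field and its trace *)

Lemma unity_root_norm1 k (x : algC) : (0 < k)%N -> x ^+ k = 1 -> `|x| = 1.
Proof.
move=> k0 xk; apply/eqP; rewrite -(pexpr_eq1 k0) ?normr_ge0 // -normrX xk normr1 //.
Qed.

Lemma conj_norm1 (x : algC) : `|x| = 1 -> x^* = x^-1.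
Proof. by move=> x1; rewrite invC_norm x1 expr1n invr1 mul1r. Qed.

Section Cyclotomic.
Variables (s : nat) (hs : (3 <= s)%N).
Local Notation z := (zeta s).

Lemma zetaXhalf : z ^+ (2 ^ s.-1) = -1.
Proof. by rewrite /zeta rootCK // expn_gt0. Qed.

Lemma zetaXn : z ^+ (2 ^ s) = 1.
Proof.
have -> : s = s.-1.+1 by lia.
by rewrite expnSr exprM /= zetaXhalf sqrrN expr1n.
Qed.

Lemma zeta_prim : (2 ^ s)%N.-primitive_root z.
Proof.
have n0 : (0 < 2 ^ s)%N by rewrite expn_gt0.
have [k primk /(dvdn_pfactor _ _ (isT : prime 2))[j lejs Dk]] := prim_order_exists n0 zetaXn.
move: lejs; rewrite leq_eqVlt => /orP[/eqP Ej | ltjs]; first by rewrite Ej in Dk; rewrite -Dk.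
have /eqP : z ^+ (2 ^ s.-1) = 1.
  apply/eqP; rewrite -(prim_order_dvd primk) Dk dvdn_exp2l //; lia.
by rewrite zetaXhalf eq_sym -addr_eq0 -(natrD _ 1 1) pnatr_eq0.
Qed.

Lemma zeta_neq0 : z != 0.
Proof.
apply/eqP => z0; have := zetaXn; rewrite z0 expr0n expn_eq0 /=.
by move/eqP; rewrite eq_sym oner_eq0.
Qed.

Lemma zeta_conj : z^* = z^-1.
Proof. by apply/conj_norm1/(unity_root_norm1 _ zetaXn); rewrite expn_gt0. Qed.

(** This is [2 cos (2 pi k / n)], the relative trace of [z ^+ k] from K to F. *)
Definition thetak k : algC := z ^+ k + z ^- k.

Lemma zetaVX k : (k <= 2 ^ s)%N -> z ^- k = z ^+ (2 ^ s - k).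
Proof.
move=> lek; apply: (@mulfI _ (z ^+ k)); first by rewrite expf_neq0 ?zeta_neq0.
by rewrite -exprD subnKC // zetaXn mulfV // expf_neq0 ?zeta_neq0.
Qed.

Lemma Ounder_subring : is_subring (Ounder s).
Proof. exact: polyimage_subring. Qed.
Lemma Ffield_subring : is_subring (Ffield s).
Proof. exact: polyimage_subring. Qed.
Lemma Kfield_subring : is_subring (Kfield s).
Proof. exact: polyimage_subring. Qed.
Lemma Ffield_rat a : Ffield s (ratr a).
Proof. exact: (polyimageC (ratr : {rmorphism rat -> algC}) (theta s)). Qed.
Lemma Kfield_rat a : Kfield s (ratr a).
Proof. exact: (polyimageC (ratr : {rmorphism rat -> algC}) (zeta s)). Qed.
Lemma Kfield_zeta : Kfield s z.
Proof. exact: (polyimageX (ratr : {rmorphism rat -> algC}) (zeta s)). Qed.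
Lemma Ffield_inv x : Ffield s x -> Ffield s x^-1.
Proof. by apply: subring_inv; [exact: Ffield_subring|exact: Ffield_rat]. Qed.
Lemma Kfield_inv x : Kfield s x -> Kfield s x^-1.
Proof. by apply: subring_inv; [exact: Kfield_subring|exact: Kfield_rat]. Qed.
Lemma Ffield_div x y : Ffield s x -> Ffield s y -> Ffield s (x / y).
Proof. by move=> Fx Fy; apply: subringM; [exact: Ffield_subring|by []|exact: Ffield_inv]. Qed.
Lemma Ounder_theta : Ounder s (theta s).
Proof. exact: (polyimageX (intr : {rmorphism int -> algC}) (theta s)). Qed.

Lemma Ounder_sub (R : algC -> Prop) :
  is_subring R -> R (theta s) -> forall x, Ounder s x -> R x.
Proof.
move=> hR Rt x; apply: (sub_polyimage (f := intr : {rmorphism int -> algC})) => //.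
by move=> c; exact: subring_int.
Qed.
Lemma Ffield_sub (R : algC -> Prop) : is_subring R ->
  (forall a : rat, R (ratr a)) -> R (theta s) -> forall x, Ffield s x -> R x.
Proof.
by move=> hR Rq Rt x; apply: (sub_polyimage (f := ratr : {rmorphism rat -> algC})).
Qed.
Lemma Kfield_sub (R : algC -> Prop) : is_subring R ->
  (forall a : rat, R (ratr a)) -> R z -> forall x, Kfield s x -> R x.
Proof.
by move=> hR Rq Rt x; apply: (sub_polyimage (f := ratr : {rmorphism rat -> algC})).
Qed.

Lemma Ounder_thetak k : Ounder s (thetak k).
Proof.
have hO := Ounder_subring.
(* The recurrence has order two, so the induction carries consecutive pairs. *)
suff [] : Ounder s (thetak k) /\ Ounder s (thetak k.+1) by [].
elim: k => [|k [IH0 IH1]].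
  split; last by rewrite /thetak expr1; exact: Ounder_theta.
  by rewrite /thetak expr0 invr1; apply: subringD => //; exact: subring1.
split=> //.
have -> : thetak k.+2 = theta s * thetak k.+1 - thetak k.
  rewrite /thetak /theta !exprS; field; rewrite zeta_neq0 expf_neq0 ?zeta_neq0 //.
by apply: subringB => //; apply: subringM => //; exact: Ounder_theta.
Qed.

Lemma Ounder_Aint x : Ounder s x -> x \in Aint.
Proof.
have Az : z \in Aint by exact: Aint_prim_root zeta_prim.
apply: (Ounder_sub Aint_subringP); rewrite /theta -[z^-1]expr1 exprVn zetaVX ?expn_gt0 //.
by rewrite rpredD ?rpredX.
Qed.

Lemma Ounder_Ffield x : Ounder s x -> Ffield s x.
Proof.
apply: (Ounder_sub Ffield_subring).
exact: (polyimageX (ratr : {rmorphism rat -> algC}) (theta s)).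
Qed.

Lemma Ffield_thetak k : Ffield s (thetak k).
Proof. exact/Ounder_Ffield/Ounder_thetak. Qed.

Lemma Ffield_Kfield x : Ffield s x -> Kfield s x.
Proof.
have hK := Kfield_subring; apply: (Ffield_sub Kfield_subring); first exact: Kfield_rat.
by apply: subringD => //; [|apply: Kfield_inv]; exact: Kfield_zeta.
Qed.

Lemma Ffield_conj x : Ffield s x -> x^* = x.
Proof.
apply: (Ffield_sub (R := fun x => x^* = x)) => [|a|].
- by split=> [|y t Ey Et|y t Ey Et]; rewrite ?rmorph1 ?rmorphB ?rmorphM /= ?Ey ?Et.
- exact: fmorph_rat.
- by rewrite rmorphD /= fmorphV /= zeta_conj invrK addrC.
Qed.

Lemma Ffield_real x : Ffield s x -> x \is Num.real.
Proof. by move=> Fx; apply/CrealP/Ffield_conj. Qed.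

(** An even exponent would send [-1 = z ^ (n/2)] to 1. *)
Lemma aut_zeta (tau : {rmorphism algC -> algC}) : exists2 k, odd k & tau z = z ^+ k.
Proof.
have [|k Dk] := prim_rootP zeta_prim (x := tau z); first by rewrite -rmorphXn /= zetaXn rmorph1.
exists k => //; apply: contraT => evk.
have Ek : nat_of_ord k = (k./2 * 2)%N by lia.
have : tau (z ^+ (2 ^ s.-1)) = 1.
  rewrite rmorphXn /= Dk Ek -!exprM mulnAC -mulnA -expnSr prednK; last by lia.
  by rewrite mulnC exprM zetaXn expr1n.
by rewrite zetaXhalf rmorphN1 => /eqP; rewrite eq_sym -addr_eq0 -(natrD _ 1 1) pnatr_eq0.
Qed.

Lemma aut_theta (tau : {rmorphism algC -> algC}) k : tau z = z ^+ k -> tau (theta s) = thetak k.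
Proof. by move=> Dk; rewrite rmorphD /= fmorphV /= Dk. Qed.

Lemma Ffield_aut (tau : {rmorphism algC -> algC}) x : Ffield s x -> Ffield s (tau x).
Proof.
apply: (Ffield_sub (R := fun x => Ffield s (tau x))) => [|a|].
- have hF := Ffield_subring.
  split=> [|y t Ey Et|y t Ey Et]; rewrite ?rmorph1 ?rmorphB ?rmorphM /=.
  + exact: subring1.
  + exact: subringB.
  + exact: subringM.
- by rewrite fmorph_rat; exact: Ffield_rat.
- by have [k _ Dk] := aut_zeta tau; rewrite (aut_theta Dk); exact: Ffield_thetak.
Qed.

Lemma Ffield_eq_aut (tau tau' : {rmorphism algC -> algC}) x :
  tau (theta s) = tau' (theta s) -> Ffield s x -> tau x = tau' x.
Proof.
move=> Et; apply: (Ffield_sub (R := fun x => tau x = tau' x)) => // [|a].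
- by split=> [|y t Ey E2|y t Ey E2]; rewrite ?rmorph1 ?rmorphB ?rmorphM /= ?Ey ?E2.
- by rewrite !fmorph_rat.
Qed.

Lemma Kfield_eq_aut (tau tau' : {rmorphism algC -> algC}) x :
  tau z = tau' z -> Kfield s x -> tau x = tau' x.
Proof.
move=> Et; apply: (Kfield_sub (R := fun x => tau x = tau' x)) => // [|a].
- by split=> [|y t Ey E2|y t Ey E2]; rewrite ?rmorph1 ?rmorphB ?rmorphM /= ?Ey ?E2.
- by rewrite !fmorph_rat.
Qed.

Lemma coprime_odd_n k : coprime k.*2.+1 (2 ^ s).
Proof. by rewrite coprimeXr // coprimen2 /= odd_double. Qed.

Definition oddaut k : {rmorphism algC -> algC} := sval (Qn_aut_exists (coprime_odd_n k)).

Lemma oddaut_unity k x : x ^+ (2 ^ s) = 1 -> oddaut k x = x ^+ k.*2.+1.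
Proof. exact: (svalP (Qn_aut_exists (coprime_odd_n k))). Qed.

Lemma oddaut0 x : Kfield s x -> oddaut 0 x = x.
Proof.
move=> Kx; apply: (Kfield_eq_aut (tau' := idfun)) => //=.
by rewrite oddaut_unity ?expr1 ?zetaXn.
Qed.

(** On K this is the trace to Q: the odd exponents below n are [2k + 1] with [k < n/2]. *)
Definition cyclo_trace y := \sum_(k < 2 ^ s.-1) oddaut k y.

Lemma sum_unity k (x : algC) : x ^+ k = 1 -> x != 1 -> \sum_(i < k) x ^+ i = 0.
Proof.
move=> xk nx1; apply/eqP; have := subrX1 x k; rewrite xk subrr => /esym/eqP.
by rewrite mulf_eq0 subr_eq0 (negPf nx1).
Qed.

(** The trace is [z ^+ j] times a geometric series of ratio [z ^ (2j)]; the series vanishes unless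
    the ratio is 1, and then [z ^+ j] is a sign. *)
Lemma tr_zeta_rat j : cyclo_trace (z ^+ j) \in Crat.
Proof.
rewrite /cyclo_trace; under eq_bigr => k _.
  rewrite oddaut_unity; last by rewrite exprAC zetaXn expr1n.
  rewrite exprS -mul2n exprM; over.
rewrite -mulr_sumr.
have [E | ne1] := eqVneq ((z ^+ j) ^+ 2) 1.
  have /orP[/eqP-> | /eqP->] : (z ^+ j == 1) || (z ^+ j == -1) by rewrite -sqrf_eq1 E.
    by rewrite rpredM ?rpred1 // rpred_sum // => i _; rewrite !rpredX ?rpred1.
  by rewrite rpredM ?rpredN1 // rpred_sum // => i _; rewrite !rpredX ?rpredN1.
rewrite sum_unity ?mulr0 ?rpred0 // -exprM -expnS prednK; last by lia.
by rewrite exprAC zetaXn expr1n.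
Qed.

Lemma tr_sum (I : Type) (r : seq I) (f : I -> algC) :
  cyclo_trace (\sum_(i <- r) f i) = \sum_(i <- r) cyclo_trace (f i).
Proof. by rewrite /cyclo_trace exchange_big /=; apply: eq_bigr => k _; rewrite rmorph_sum. Qed.

Lemma tr_rat y : Kfield s y -> cyclo_trace y \in Crat.
Proof.
case=> P ->; rewrite horner_coef tr_sum rpred_sum // => i _.
have -> : cyclo_trace ((map_poly ratr P)`_i * z ^+ i) = ratr P`_i * cyclo_trace (z ^+ i).
  by rewrite /cyclo_trace mulr_sumr; apply: eq_bigr => k _; rewrite coef_map rmorphM /= fmorph_rat.
by rewrite rpredM ?Crat_rat ?tr_zeta_rat.
Qed.

Lemma Kfield_zetaVX k : Kfield s (z ^- k).
Proof.
by apply: Kfield_inv; apply: subringX; [exact: Kfield_subring|exact: Kfield_zeta].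
Qed.

Lemma tr_coord_rat x i : Kfield s x -> cyclo_trace (x * z ^- i) \in Crat.
Proof.
by move=> Kx; apply: tr_rat; apply: subringM => //; [exact: Kfield_subring|exact: Kfield_zetaVX].
Qed.

Lemma oddaut_zetaV k i : oddaut k (z ^- i) = z ^- (i * k.*2.+1).
Proof. by rewrite fmorphV rmorphXn /= oddaut_unity ?zetaXn // -exprM mulnC. Qed.

(** Fourier inversion: after exchanging the sums, the automorphism of index [k] is weighted by the
    sum of all powers of [z ^ (-2k)], which is n for [k = 0] and 0 otherwise. *)
Lemma tr_inversion x : Kfield s x -> (2 ^ s)%:R * x = \sum_(i < 2 ^ s) cyclo_trace (x * z ^- i) * z ^+ i.
Proof.
move=> Kx; under eq_bigr => i _ do rewrite mulr_suml.
rewrite exchange_big /= (bigD1 (Ordinal (_ : 0 < 2 ^ s.-1)%N)) ?expn_gt0 //= => ltp.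
rewrite [X in _ + X]big1 ?addr0; last first.
  move=> k nek0; have k0 : (0 < k)%N.
    by rewrite lt0n; apply: contraNneq nek0 => E; apply/eqP/val_inj.
  under eq_bigr => i _.
    rewrite rmorphM /= oddaut_zetaV -mulrA.
    have -> : z ^- (i * k.*2.+1) * z ^+ i = (z ^- k.*2) ^+ i.
      rewrite exprVn -exprM (mulnC k.*2) mulnS exprD invfM mulrC mulrA.
      by rewrite mulfV ?mul1r // expf_neq0 ?zeta_neq0.
    over.
  rewrite -mulr_sumr sum_unity ?mulr0 //.
    by rewrite exprVn exprAC zetaXn expr1n invr1.
  rewrite invr_eq1 -(prim_order_dvd zeta_prim); apply/negP => /dvdn_leq.
  have := ltn_ord k; have E: (2 ^ s = 2 * 2 ^ s.-1)%N by rewrite -expnS prednK //; lia.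
  by rewrite E; lia.
transitivity (\sum_(i < 2 ^ s) x).
  by rewrite sumr_const card_ord mulr_natl.
apply: eq_bigr => i _; rewrite rmorphM /= oddaut_zetaV muln1 oddaut0 // -mulrA mulVf ?mulr1 //.
by rewrite expf_neq0 ?zeta_neq0.
Qed.

Lemma tr_Aint y : y \in Aint -> cyclo_trace y \in Aint.
Proof. by move=> Ay; rewrite rpred_sum // => k _; rewrite Aint_aut. Qed.

Lemma zetaVX_Aint i : z ^- i \in Aint.
Proof.
apply: (@Aint_unity_root (2 ^ s)); rewrite ?expn_gt0 //; apply/unity_rootP.
by rewrite exprVn exprAC zetaXn expr1n invr1.
Qed.

Lemma tr_coord_int x i : Kfield s x -> x \in Aint -> exists c : int, cyclo_trace (x * z ^- i) = c%:~R.
Proof.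
move=> Kx Ax; apply/intrP/Cint_rat_Aint; first exact: tr_coord_rat.
by rewrite tr_Aint // rpredM // zetaVX_Aint.
Qed.

End Cyclotomic.

(** * The integers of F and the prime p *)

Section Integers.
Variables (s : nat) (hs : (3 <= s)%N).
Local Notation z := (zeta s).
Local Notation O := (Ounder s).
Local Notation F := (Ffield s).
Local Notation p := (pgen s).
Let hO := Ounder_subring s.
Let hF := Ffield_subring s.
Let O2 : O 2. Proof. exact: (subring_nat hO 2). Qed.

Lemma Ounder_pgen : O p.
Proof. by apply: subringD => //; exact: Ounder_theta. Qed.

Lemma thetak_double k : thetak s k.*2 = thetak s k ^+ 2 - 2.
Proof.
rewrite /thetak -mul2n mulnC exprM -exprVn; set y := z ^+ k.
have y0 : y != 0 by rewrite expf_neq0 ?zeta_neq0.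
by field.
Qed.

(** [z ^ (n/4)] is a square root of -1, so its inverse is its opposite. *)
Lemma thetak_quarter : thetak s (2 ^ (s - 2)) = 0.
Proof.
rewrite /thetak; set y := z ^+ _.
have y2 : y * y = -1.
  rewrite -expr2 -exprM -expnSr (_ : (s - 2).+1 = s.-1) ?zetaXhalf //; lia.
have y0 : y != 0 by rewrite expf_neq0 ?zeta_neq0.
by apply: (mulfI y0); rewrite mulrDr y2 divff // mulr0 addNr.
Qed.

(** The root is [thetak] at n/8, an integer because [n >= 8]; its square exceeds [thetak] at n/4,
    which is 0, by 2. *)
Lemma sqrt2_Ffield : exists2 r, F r & r ^+ 2 = 2.
Proof.
exists (thetak s (2 ^ (s - 3))); first exact: Ffield_thetak.
apply/eqP; rewrite -subr_eq0 -thetak_double -mul2n -expnS.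
by rewrite (_ : (s - 3).+1 = (s - 2)%N) ?thetak_quarter //; lia.
Qed.

Lemma pgen_dvd2 : exists2 u, O u & 2 = p * u.
Proof.
(* Doubling the index preserves the congruence to 2 modulo [p]; at n/4 it reads [0 = 2 + p r]. *)
have claim j : exists2 r, O r & thetak s (2 ^ j.+1) = 2 + p * r.
  elim: j => [|j [r Or Dr]]; rewrite expnS mul2n thetak_double.
    exists (p - 4); first by apply: subringB => //; [exact: Ounder_pgen|exact: (subring_nat hO 4)].
    by rewrite /thetak expr1 -/(theta s) /pgen; ring.
  exists (4 * r + p * r ^+ 2); last by rewrite Dr; ring.
  by apply: subringD => //; apply: subringM => //; [exact: (subring_nat hO 4)
    |exact: Ounder_pgen|exact: subringX].
have [r Or] := claim (s - 3)%N.
rewrite (_ : (s - 3).+1 = (s - 2)%N) ?thetak_quarter; last by lia.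
move/esym/eqP; rewrite addr_eq0 => /eqP D2.
by exists (- r); [exact: subringN | rewrite mulrN].
Qed.

(** Modulo 2, squaring [thetak k] doubles its index, so [p ^ (2^j)] is congruent to [thetak (2^j)],
    which vanishes at n/4. *)
Lemma pgenX_dvd2 : exists2 u, O u & p ^+ (2 ^ (s - 2)) = 2 * u.
Proof.
have claim j : exists2 r, O r & p ^+ (2 ^ j) = thetak s (2 ^ j) + 2 * r.
  elim: j => [|j [r Or Dr]].
    by exists 1; [exact: subring1 | rewrite /thetak !expr1 -/(theta s) /pgen; ring].
  rewrite expnSr exprM Dr muln2 thetak_double.
  exists (1 + 2 * thetak s (2 ^ j) * r + 2 * r ^+ 2); last by ring.
  apply: subringD => //; last by apply: subringM => //; exact: subringX.
  apply: subringD => //; first exact: subring1.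
  by apply: subringM => //; apply: subringM => //; exact: Ounder_thetak.
by have [r Or ->] := claim (s - 2)%N; exists r; rewrite ?thetak_quarter ?add0r.
Qed.

Lemma pgen_neq0 : p != 0.
Proof.
have [u _ D2] := pgen_dvd2; apply/eqP => p0; move/eqP: D2.
by rewrite p0 mul0r pnatr_eq0.
Qed.

(** It suffices to treat the generator, and [theta = -2 + p]. *)
Lemma Ounder_mod_pgen x :
  O x -> exists2 c : int, True & exists2 r, O r & x = c%:~R + p * r.
Proof.
have Op := Ounder_pgen.
apply: (Ounder_sub (R := fun x =>
  exists2 c : int, True & exists2 r, O r & x = c%:~R + p * r)); last first.
  by exists (-2) => //; exists 1; [exact: subring1 | rewrite rmorphN /= /pgen mulr1 addKr].
exact: residue_subring.
Qed.

Lemma ring_of_integers_Ffield x : F x -> x \in Aint -> O x.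
Proof.
move=> Fx Ax; have Kx := Ffield_Kfield Fx.
apply: (integral_descent (p := p) (k := (2 ^ (s - 2))%N) (N := s.+1) hO) => //.
- by move=> y; exact: Ounder_Aint.
- exact: Ounder_pgen.
- exact: pgen_dvd2.
- exact: pgenX_dvd2.
- exact: Ounder_mod_pgen.
have E := tr_inversion hs Kx.
(* As [x] is real, adding the inversion formula to its complex conjugate replaces each [z ^+ i] by
   [thetak i], so [2 ^+ s.+1 * x] lies in O. *)
have E' : (2 ^ s)%:R * x = \sum_(i < 2 ^ s) cyclo_trace s (x * z ^- i) * z ^- i.
  have := congr1 Num.conj E; rewrite rmorphM /= rmorph_nat (Ffield_conj hs Fx) => ->.
  rewrite rmorph_sum; apply: eq_bigr => i _; rewrite rmorphM rmorphXn /= zeta_conj // exprVn.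
  by rewrite conj_Crat // tr_coord_rat.
have -> : 2 ^+ s.+1 * x = \sum_(i < 2 ^ s) cyclo_trace s (x * z ^- i) * thetak s i.
  under eq_bigr do rewrite mulrDr; rewrite big_split /= -E -E' exprS natrX; ring.
apply: subring_sum => // i _; apply: subringM => //; last exact: Ounder_thetak.
by have [c ->] := tr_coord_int hs i Kx Ax; exact: subring_int.
Qed.

Lemma pgen_not_unit : p^-1 \notin Aint.
Proof.
have [u Ou Dp] := pgenX_dvd2; apply: contra half_notin_Aint => Ap.
have -> : 2^-1 = p^-1 ^+ (2 ^ (s - 2)) * u; last first.
  by rewrite rpredM ?rpredX //; apply: Ounder_Aint Ou.
have nz2 : 2 != 0 :> algC by rewrite pnatr_eq0.
apply: (mulfI nz2); rewrite mulfV // mulrCA -Dp exprVn mulVf //.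
by rewrite expf_neq0 // pgen_neq0.
Qed.

Lemma pgen_dvd_int (c : int) : c%:~R / p \in Aint -> exists c', c = c' * 2.
Proof.
move=> Ac; have [c' [] Dc] := int_parity c; first by exists c'.
have [u Ou D2] := pgen_dvd2.
case/negP: pgen_not_unit; have -> : p^-1 = c%:~R / p - c'%:~R * u.
  have E : c%:~R = c'%:~R * (p * u) + 1 :> algC by rewrite -D2 Dc rmorphD rmorphM.
  by rewrite E; field; exact: pgen_neq0.
by rewrite rpredB // rpredM ?Aint_int // (Ounder_Aint hs Ou).
Qed.

(** Write [x = c + p r] with [c] an integer: [p] divides [c ^+ 2], so [c] is even, and [p] divides
    2. *)
Lemma pgen_dvd_sqr x : O x -> x ^+ 2 / p \in Aint -> O (x / p).
Proof.
move=> Ox Ax2; have [c _ [r Or Dx]] := Ounder_mod_pgen Ox.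
have Op := Ounder_pgen; have hc := subring_int hO c.
have [c' Dc] : exists c', c ^+ 2 = c' * 2.
  apply: pgen_dvd_int; rewrite rmorphXn /=.
  have -> : c%:~R ^+ 2 / p = x ^+ 2 / p - (2 * c%:~R * r + p * r ^+ 2).
    by rewrite Dx; field; exact: pgen_neq0.
  rewrite rpredB // (Ounder_Aint hs) //; apply: subringD => //.
    by apply: subringM => //; apply: subringM.
  by apply: subringM => //; exact: subringX.
have [c2 Dc2] : exists c2, c = c2 * 2.
  have [c2 [-> | Dc2]] := int_parity c; first by exists c2.
  exfalso; move: Dc; rewrite Dc2 expr2; set a := c2 * c2; set b := c2.
  have -> : (b * 2 + 1) * (b * 2 + 1) = (a * 2 + b * 2) * 2 + 1 by rewrite /a /b; ring.
  lia.
have [u Ou D2] := pgen_dvd2.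
have -> : x / p = c2%:~R * u + r.
  have E : c%:~R = c2%:~R * (p * u) :> algC by rewrite -D2 Dc2 rmorphM.
  by rewrite Dx E; field; exact: pgen_neq0.
by apply: subringD => //; apply: subringM => //; exact: subring_int.
Qed.

(* Odd primes are unramified in [K]: if [l] divides [x^2] then [x / sqrt l] is integral, so every
   trace coordinate of [x] is an integer divisible by [sqrt l], hence by [l]. *)
Lemma odd_prime_dvd_sqr (l : nat) x : prime l -> odd l -> Kfield s x -> x \in Aint ->
  x ^+ 2 / l%:R \in Aint -> x / l%:R \in Aint.
Proof.
move=> pl ol Kx Ax Axl; pose t : algC := sqrtC l%:R.
have t2 : t ^+ 2 = l%:R by exact: sqrtCK.
have nzl : l%:R != 0 :> algC by rewrite pnatr_eq0 -lt0n prime_gt0.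
have coord i : cyclo_trace s (x * z ^- i) / l%:R \in Aint.
  have [c Dc] := tr_coord_int hs i Kx Ax.
  have : cyclo_trace s (x * z ^- i) / t \in Aint.
    rewrite /cyclo_trace mulr_suml rpred_sum // => k _; apply: (@Aint_root 2) => //.
    rewrite expr_div_n t2 -rmorphXn /= exprMn.
    have -> : oddaut s k (x ^+ 2 * (z ^- i) ^+ 2) / l%:R
        = oddaut s k (x ^+ 2 / l%:R * (z ^- i) ^+ 2).
      by move: (x ^+ 2) ((z ^- i) ^+ 2) => a b; rewrite !rmorphM fmorphV rmorph_nat mulrAC.
    by rewrite Aint_aut rpredM // rpredX // zetaVX_Aint.
  rewrite Dc => /(rpredX 2); rewrite expr_div_n t2 => Ac.
  have /intrP[e] : (c%:~R ^+ 2 / l%:R : algC) \is a Num.int.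
    by apply: Cint_rat_Aint => //; rewrite rpred_div ?rpredX ?rpred_int ?rpred_nat.
  move/(canRL (divfK nzl)); rewrite -rmorphXn -[l%:R]/(l%:~R) -intrM => /intr_inj Ee.
  have : (l %| `|c| ^ 2)%N.
    by rewrite -abszX Ee abszM; apply: dvdn_mull.
  rewrite Euclid_dvdX // => /andP[/dvdnP[d Dd] _].
  have [b Db] : exists b : int, c = b * l.
    exists (sgz c * d); rewrite [LHS]intEsg Dd PoszM; ring.
  by rewrite Db intrM mulfK // Aint_int.
have An : (2 ^ s)%:R * x / l%:R \in Aint.
  rewrite (tr_inversion hs Kx) mulr_suml rpred_sum // => i _.
  rewrite mulrAC rpredM ?coord // rpredX //; exact: Aint_prim_root (zeta_prim hs).
(* Now [n x / l] is integral, and a Bezout relation between [l] and n removes the factor n. *)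
have /eqP cop : coprime l (2 ^ s) by rewrite coprimeXr // coprimen2.
have [a b Dab _] := egcdnP (2 ^ s) (prime_gt0 pl).
have -> : x / l%:R = a%:R * x - b%:R * ((2 ^ s)%:R * x / l%:R).
  have E : a%:R * l%:R = b%:R * (2 ^ s)%:R + 1 :> algC by rewrite -!natrM Dab cop natrD.
  rewrite -[x in LHS](addKr (b%:R * (2 ^ s)%:R * x)) -[X in _ + (_ + X)]mul1r -mulrDl -E.
  by field.
by rewrite rpredB // rpredM // Aint_Cnat ?natr_nat.
Qed.

End Integers.

(** * Totally positive units are squares *)

(** For odd [b] this is the exact 2-adic valuation [a + 2] of [5 ^ (2^a b) - 1], hence the order of
    5 modulo powers of 2. *)
Lemma five_pow_pow2 a b :
  exists2 q, odd q = odd b & (5 ^ (2 ^ a * b) = 1 + 2 ^ a.+2 * q)%N.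
Proof.
have [o oo Do] : exists2 o, odd o & (5 ^ (2 ^ a) = 1 + 2 ^ a.+2 * o)%N.
  elim: a => [|a [o oo Do]]; first by exists 1%N.
  exists (o + 2 ^ a.+1 * o ^ 2)%N.
    by rewrite oddD oo expnS -mulnA oddM.
  rewrite expnSr expnM Do !expnS; set c := (2 ^ a)%N; rewrite !expn0; ring.
elim: b => [|b [q oq Dq]]; first by exists 0%N; rewrite ?muln0.
exists (q + 5 ^ (2 ^ a * b) * o)%N.
  by rewrite oddD oddM oddX oo orbT /= oq addbT.
by rewrite mulnS addnC expnD Do {1}mulnDr muln1 Dq; ring.
Qed.

(** The units modulo [2 ^ (t+2)] are generated by -1 and 5. To lift to the next modulus when [d] is
    odd, the power of 5 is multiplied by [5 ^ (2^t) = 1 + 2 ^ (t+2) q] with [q] odd. *)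
Lemma odd_five_pow k t : odd k -> exists e : int, exists j, exists2 d : int,
  (e == 1) || (e == -1) & k%:Z = e * (5 ^ j)%N%:Z + (2 ^ t.+2)%N%:Z * d.
Proof.
move=> ok; elim: t => [|t [e [j [d De Dk]]]].
  have [E | E] : (k %% 4 = 1 \/ k %% 4 = 3)%N by lia.
    exists 1, 0%N, (k %/ 4)%N%:Z => //; lia.
  exists (-1), 0%N, ((k %/ 4)%N%:Z + 1) => //; lia.
have [d' [Dd | Dd]] := int_parity d.
  exists e, j, d' => //; rewrite Dk Dd (expnS 2 t.+2) PoszM; ring.
have [q /= oq Dq] := five_pow_pow2 t 1; rewrite muln1 in Dq.
have [o Do] : exists o : int, e * q%:Z * (5 ^ j)%N%:Z = o * 2 + 1.
  have [o [Do | ]] := int_parity (e * q%:Z * (5 ^ j)%N%:Z); last by exists o.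
  have o5 : odd (5 ^ j) by rewrite oddX orbT.
  have : odd `|e * q%:Z * (5 ^ j)%N%:Z|.
    by rewrite !abszM !oddM !absz_nat oq o5 !andbT; case/orP: De => /eqP->.
  by rewrite Do; lia.
exists e, (j + 2 ^ t)%N, (d' - o) => //.
have E3 : (2 ^ t.+3)%N%:Z = 2 * (2 ^ t.+2)%N%:Z by rewrite expnS PoszM.
rewrite E3 expnD Dq Dk Dd (PoszM (5 ^ j)%N) PoszD (PoszM _ q).
have -> : (2 ^ t.+2)%N%:Z * (d' * 2 + 1) =
  2 * (2 ^ t.+2)%N%:Z * (d' - o) + (2 ^ t.+2)%N%:Z * (o * 2 + 1) by ring.
rewrite -Do; move: (2 ^ t.+2)%N%:Z (5 ^ j)%N%:Z q%:Z => A B C. ring.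
Qed.

Section Weber.
Variables (s : nat) (hs : (3 <= s)%N).
Local Notation z := (zeta s).
Local Notation O := (Ounder s).
Local Notation F := (Ffield s).
Local Notation p := (pgen s).
Local Notation m := (2 ^ (s - 2))%N.
Let hO := Ounder_subring s.
Let hF := Ffield_subring s.

(* The powers of a generator of the cyclic group Gal(F/Q). *)
Definition sg j := oddaut s (5 ^ j)./2.

Lemma sg_unity j x : x ^+ (2 ^ s) = 1 -> sg j x = x ^+ (5 ^ j).
Proof.
move=> xn; rewrite /sg oddaut_unity //; congr (_ ^+ _).
by have : odd (5 ^ j) by [rewrite oddX orbT]; lia.
Qed.

Lemma sg_zeta j : sg j z = z ^+ (5 ^ j).
Proof. by rewrite sg_unity ?zetaXn. Qed.

Lemma sg_comp i j x : F x -> sg i (sg j x) = sg (i + j) x.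
Proof.
move=> /Ffield_Kfield; apply: (Kfield_eq_aut (tau := sg i \o sg j : {rmorphism algC -> algC})).
by rewrite /= !sg_zeta rmorphXn /= sg_zeta -exprM expnD.
Qed.

Lemma sg0 x : F x -> sg 0 x = x.
Proof.
move=> /Ffield_Kfield; apply: (Kfield_eq_aut (tau' := idfun)).
by rewrite /= !sg_zeta expr1.
Qed.

Lemma five_pow_m : exists2 q, odd q & (5 ^ m = 1 + 2 ^ s * q)%N.
Proof.
have [q oq] := five_pow_pow2 (s - 2) 1; rewrite muln1 (_ : (s - 2).+2 = s); last by lia.
by exists q.
Qed.

Lemma sgm x : F x -> sg m x = x.
Proof.
move=> /Ffield_Kfield; apply: (Kfield_eq_aut (tau' := idfun)) => /=.
have [q _ Dq] := five_pow_m.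
by rewrite /= !sg_zeta Dq exprD expr1 exprM zetaXn // expr1n mulr1.
Qed.

Lemma sg_Ffield j x : F x -> F (sg j x).
Proof. exact: Ffield_aut. Qed.

(** Inverting [z] does not change [theta], so on F each [oddaut k] agrees with a power of sigma. The
    trace of a fixed [x] is then [(n/2) x], and traces are rational. *)
Lemma sg_fixed_rat x : F x -> sg 1 x = x -> x \in Crat.
Proof.
move=> Fx x1; have fixj j : sg j x = x.
  by elim: j => [|j IHj]; [exact: sg0 | rewrite -addn1 -sg_comp // x1].
have fixk k : oddaut s k x = x.
  have [|e [j [d De Dk]]] := @odd_five_pow k.*2.+1 (s - 2); first by rewrite /= odd_double.
  rewrite -[RHS](fixj j); apply: (@Ffield_eq_aut s) => //.
  have -> : oddaut s k (theta s) = thetak s k.*2.+1.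
    by apply: aut_theta; rewrite oddaut_unity ?zetaXn.
  rewrite (aut_theta (sg_zeta j)).
  have Ez : z ^+ k.*2.+1 = z ^ (e * (5 ^ j)%N%:Z).
    rewrite -[LHS]/(z ^ (k.*2.+1)%:Z) Dk expfzDr ?zeta_neq0 // -(exprz_exp _ (2 ^ (s - 2).+2)%N).
    rewrite (_ : (s - 2).+2 = s); last by lia.
    by rewrite -[z ^ (2 ^ s)%N%:Z]/(z ^+ (2 ^ s)) zetaXn // exp1rz mulr1.
  rewrite /thetak Ez; case/orP: De => /eqP->; first by rewrite mul1r.
  by rewrite mulN1r -exprnN invrK addrC.
have E : cyclo_trace s x = (2 ^ s.-1)%:R * x.
  by rewrite /cyclo_trace; under eq_bigr do rewrite fixk; rewrite sumr_const card_ord mulr_natl.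
have nz : (2 ^ s.-1)%:R != 0 :> algC by rewrite pnatr_eq0 -lt0n expn_gt0.
have -> : x = (2 ^ s.-1)%:R^-1 * cyclo_trace s x by rewrite E mulKf.
rewrite rpredM ?rpredV ?rpred_nat //.
exact/tr_rat/Ffield_Kfield.
Qed.

(** The 2-adic valuation of [5 ^ i - 1] is two more than that of [i], hence less than [s]. *)
Lemma five_pow_neq1 i : (0 < i < m)%N -> z ^+ (5 ^ i) != z.
Proof.
case/andP=> i0 im; rewrite -{2}[z]expr1 (eq_prim_root_expr (zeta_prim hs)).
have [b cb Di] := pfactor_coprime (isT : prime 2) i0; rewrite coprime2n in cb.
set a := logn 2 i in Di; have [q] := five_pow_pow2 a b; rewrite cb => oq.
rewrite mulnC -Di => ->; rewrite eqn_mod_dvd ?leq_addr // addKn.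
apply/negP => dv.
have lta : (a < s - 2)%N.
  rewrite -(ltn_exp2l _ _ (isT : 1 < 2)%N); apply: leq_ltn_trans im.
  by rewrite Di leq_pmull //; case: (b) cb.
have : (2 ^ a.+3 %| 2 ^ a.+2 * q)%N by apply: dvdn_trans dv; rewrite dvdn_exp2l //; lia.
by rewrite (expnSr 2 a.+2) dvdn_pmul2l ?expn_gt0 // dvdn2 oq.
Qed.

(** [5 ^ i + 1] is 2 modulo 4, so n does not divide it. *)
Lemma five_pow_neqV i : z ^+ (5 ^ i) != z^-1.
Proof.
apply/negP => /eqP E; have : z ^+ (5 ^ i).+1 == 1.
  by rewrite exprSr E mulVf ?zeta_neq0.
rewrite -(prim_order_dvd (zeta_prim hs)) => dv.
have E4 : (5 ^ i %% 4 = 1)%N by rewrite -modnXm exp1n.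
have : (4 %| (5 ^ i).+1)%N by apply: dvdn_trans dv; rewrite (@dvdn_exp2l 2 2) //; lia.
lia.
Qed.

Lemma sum_zetaX (x : algC) : x ^+ (2 ^ s) = 1 ->
  \sum_(k < 2 ^ s) x ^+ k = if x == 1 then (2 ^ s)%:R else 0.
Proof.
move=> xn; case: eqVneq => [-> | nx]; last exact: sum_unity.
by under eq_bigr do rewrite expr1n; rewrite sumr_const card_ord.
Qed.

Lemma hilbert90 eta : F eta -> \prod_(j < m) sg j eta = 1 ->
  exists b, [/\ F b, b != 0 & b = eta * sg 1 b].
Proof.
move=> Fe Ne; pose c i := \prod_(j < i) sg j eta.
have Fc i : F (c i) by apply: subring_prod => // j _; exact: sg_Ffield.
have c0 : c 0%N = 1 by rewrite /c big_ord0.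
have cm : c m = 1 by exact: Ne.
have cS i : c i.+1 = eta * sg 1 (c i).
  rewrite /c big_ord_recl /= sg0 // rmorph_prod; congr (_ * _).
  by apply: eq_bigr => j _; rewrite /= sg_comp.
(* The Lagrange resolvent built on the partial norms [c i]; applying sigma and multiplying by [eta]
   permutes its terms cyclically. *)
pose B g := \sum_(i < m) c i * sg i g.
have FB g : F g -> F (B g).
  by move=> Fg; apply: subring_sum => // i _; apply: subringM => //; exact: sg_Ffield.
have EB g : F g -> B g = eta * sg 1 (B g).
  move=> Fg; rewrite /B rmorph_sum mulr_sumr.
  under [RHS]eq_bigr => i _ do rewrite rmorphM /= sg_comp // add1n mulrA -cS.
  apply: (@addrI _ (c m * sg m g)).
  rewrite addrC -(big_ord_recr m (fun i => c i * sg i g)) big_ord_recl /=.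
  by rewrite cm c0 sgm // sg0.
case: (pickP (fun k : 'I_(2 ^ s) => B (thetak s k) != 0)) => [k nzB | B0].
  by exists (B (thetak s k)); split=> //; [apply: FB|apply: EB]; exact: Ffield_thetak.
(* Some resolvent is nonzero: summed against [z ^- k], the resolvents of the [thetak s k] leave only
   the term [i = 0], as [sg i] sends [z] neither to [z] nor to its inverse for [0 < i < m]. The sum
   is n, not 0. *)
exfalso; have : \sum_(k < 2 ^ s) z ^- k * B (thetak s k) = 0.
  by apply: big1 => k _; have /negbFE/eqP-> := B0 k; rewrite mulr0.
have un y : y ^+ (2 ^ s) = 1 -> (y / z) ^+ (2 ^ s) = 1.
  by move=> yn; rewrite expr_div_n yn zetaXn // divr1.
have zn : z ^+ (2 ^ s) = 1 by exact: zetaXn.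
have un5 i : (z ^+ (5 ^ i)) ^+ (2 ^ s) = 1 by rewrite exprAC zn expr1n.
have un5V i : (z ^- (5 ^ i)) ^+ (2 ^ s) = 1 by rewrite exprVn un5 invr1.
have -> : \sum_(k < 2 ^ s) z ^- k * B (thetak s k) = \sum_(i < m) c i *
   (\sum_(k < 2 ^ s) (z ^+ (5 ^ i) / z) ^+ k + \sum_(k < 2 ^ s) (z ^- (5 ^ i) / z) ^+ k).
  under eq_bigr => k _ do rewrite mulr_sumr.
  rewrite exchange_big /=; apply: eq_bigr => i _.
  rewrite -big_split mulr_sumr /=; apply: eq_bigr => k _.
  rewrite mulrCA; congr (_ * _).
  rewrite /thetak rmorphD fmorphV rmorphXn /= sg_zeta mulrDr !expr_div_n.
  by congr (_ + _); rewrite mulrC ?exprVn.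
under eq_bigr => i _ do rewrite !sum_zetaX ?un //.
have m0 : (0 < m)%N by rewrite expn_gt0.
have z0 := zeta_neq0 hs.
rewrite (bigD1 (Ordinal m0)) //= big1 ?addr0 => [|i ni0]; last first.
  have ci0 : (0 < i)%N.
    by rewrite lt0n; apply: contraNneq ni0 => E; apply/eqP/val_inj.
  rewrite !ifF ?addr0 ?mulr0 //; apply/negP.
  - move/eqP/(canRL (divfK z0)); rewrite mul1r => E.
    case/negP: (five_pow_neqV i); apply/eqP.
    by rewrite -[X in _ = X^-1]E invrK.
  - move/eqP/(canRL (divfK z0)); rewrite mul1r => /eqP; apply/negP/five_pow_neq1.
    by rewrite ci0 ltn_ord.
rewrite c0 mul1r !expr1 divff // eqxx ifF ?addr0.
  by move/eqP; rewrite pnatr_eq0 expn_eq0.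
apply/negP => /eqP/(canRL (divfK z0)); rewrite mul1r => E.
by case/negP: (five_pow_neqV 0); apply/eqP; rewrite -[X in _ = X^-1]E invrK.
Qed.

Definition Fsquare x := exists2 c, F c & x = c ^+ 2.

(** A square root of [sg 1 p / p], equal to [z^-2 (1 + z^5) / (1 + z)] and written so that it
    visibly lies in F. *)
Definition eta0 := thetak s 2 - thetak s 1 + 1.

Lemma eta0_Ffield : F eta0.
Proof.
apply: subringD => //; last exact: subring1.
by apply: subringB => //; exact: Ffield_thetak.
Qed.

Lemma pgenE : p = z^-1 * (1 + z) ^+ 2.
Proof. by rewrite /pgen /theta; field; exact: zeta_neq0. Qed.

Lemma oneDzeta_neq0 : 1 + z != 0.
Proof.
by have := pgen_neq0 hs; apply: contra_neq => E; rewrite pgenE E expr0n mulr0.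
Qed.

Lemma eta0E : eta0 = z ^- 2 * (1 + z ^+ 5) / (1 + z).
Proof.
rewrite /eta0 /thetak expr1; field.
by rewrite oneDzeta_neq0 zeta_neq0.
Qed.

Lemma sg_pgen : sg 1 p = p * eta0 ^+ 2.
Proof.
rewrite pgenE eta0E rmorphM fmorphV rmorphXn rmorphD rmorph1 /= sg_zeta.
field; by rewrite oneDzeta_neq0 zeta_neq0.
Qed.

(* The product telescopes to [z ^- ((5 ^ m - 1) / 2)], and [5 ^ m = 1 + n * odd]. *)
Lemma norm_eta0 : \prod_(j < m) sg j eta0 = -1.
Proof.
have z0 := zeta_neq0 hs; have nz1 := oneDzeta_neq0.
have nza j : 1 + z ^+ (5 ^ j) != 0.
  by have := fmorph_eq0 (sg j) (1 + z); rewrite rmorphD rmorph1 /= sg_zeta (negPf nz1) => ->.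
have claim t : \prod_(j < t) sg j eta0 = z ^- (5 ^ t)./2 * (1 + z ^+ (5 ^ t)) / (1 + z).
  elim: t => [|t IHt]; first by rewrite big_ord0 expr0 invr1 mul1r expr1 divff.
  rewrite big_ord_recr /= IHt eta0E 2!rmorphM !fmorphV rmorphD rmorph1 rmorphD rmorph1 !rmorphXn /=.
  rewrite sg_zeta -!exprM.
  have -> : (5 ^ t.+1)./2 = ((5 ^ t)./2 + 5 ^ t * 2)%N.
    by rewrite expnS; have : odd (5 ^ t) by [rewrite oddX orbT]; lia.
  rewrite exprD -(expnSr 5 t) [z ^+ (5 ^ t * 2)]exprM.
  field; by rewrite nz1 (nza t) !expf_neq0.
have [q oq Dq] := five_pow_m; rewrite claim.
have -> : z ^+ (5 ^ m) = z by rewrite Dq exprD exprM zetaXn // expr1n mulr1.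
rewrite mulfK // Dq (_ : (1 + 2 ^ s * q)./2 = 2 ^ s.-1 * q)%N; last first.
  have -> : (2 ^ s = 2 * 2 ^ s.-1)%N by rewrite -expnS prednK //; lia.
  by rewrite -mulnA; lia.
by rewrite exprM zetaXhalf // -signr_odd oq expr1 invrN invr1.
Qed.

(** Descent on [r], with [b] integral because [b ^+ 2 = r / u]. An odd prime [l] dividing [r] also
    divides [b], being unramified, so [l ^ 2] is removed from [r]; a factor 4 is removed likewise.
    There remain 1 and 2, both squares in F. *)
Lemma unit_Ffield_square_nat u b (r : nat) : F u -> u \in Aint -> u^-1 \in Aint -> u != 0 ->
  F b -> (0 < r)%N -> u * b ^+ 2 = r%:R -> Fsquare u.
Proof.
move=> Fu Au Au' u0; elim/ltn_ind: r b => r IH b Fb r0 Er.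
have Eb : b ^+ 2 = r%:R * u^-1 by rewrite -Er; field.
have Ab : b \in Aint by apply: (@Aint_root 2) => //; rewrite Eb rpredM // Aint_Cnat ?natr_nat.
have b0 : b != 0.
  by apply: contraTneq r0 => E; rewrite -leqNgt leqn0 -(pnatr_eq0 algC) -Er E expr0n mulr0 eqxx.
have Eu : u = r%:R / b ^+ 2 by rewrite -Er mulfK // expf_neq0.
have descend l : prime l -> (l %| r)%N -> b / l%:R \in Aint -> Fsquare u.
  move=> pl dvl Abl; have nzl : l%:R != 0 :> algC by rewrite pnatr_eq0 -lt0n prime_gt0.
  have E : u * (b / l%:R) ^+ 2 = r%:R / (l ^ 2)%:R by rewrite expr_div_n mulrA Er natrX.
  have nzl2 : (l ^ 2)%:R != 0 :> algC by rewrite natrX expf_neq0.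
  have : (r == 0 %[mod (l ^ 2)%N])%A.
    rewrite eqAmod0 unfold_in (negPf nzl2) /= -[X in X \in _]E.
    by rewrite rpredM // rpredX.
  rewrite eqAmod0_nat => /dvdnP[r' Dr].
  have l1 := prime_gt1 pl.
  apply: (IH r' _ (b / l%:R)).
  - by rewrite Dr ltn_Pmulr // ?(ltn_exp2l 0) //; case: (r') Dr r0 => // ->.
  - by apply: Ffield_div => //; exact: (subring_nat hF).
  - by case: (r') Dr r0 => // ->.
  - by rewrite E Dr natrM mulfK.
have odd_descend l : prime l -> odd l -> (l %| r)%N -> Fsquare u.
  move=> pl ol dvl; apply: (descend l) => //.
  apply: (odd_prime_dvd_sqr hs) => //; first exact: Ffield_Kfield.
  case/dvdnP: dvl => r' Dr.
  rewrite Eb Dr natrM mulrAC mulfK ?rpredM // ?Aint_Cnat ?natr_nat //.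
  by rewrite pnatr_eq0 -lt0n prime_gt0.
case: (boolP (4 %| r)%N) => [/dvdnP[r' Dr] | n4].
  apply: (descend 2) => //; first by rewrite Dr dvdn_mull.
  apply: (@Aint_root 2) => //.
  have -> : (b / 2%:R) ^+ 2 = r'%:R * u^-1.
    rewrite expr_div_n Eb Dr natrM; field; exact: u0.
  by rewrite rpredM // Aint_Cnat ?natr_nat.
have odd_case t : (t %| r)%N -> odd t -> (1 < t)%N -> Fsquare u.
  move=> dvt ot t1; apply: (odd_descend (pdiv t)); rewrite ?pdiv_prime //.
    exact: dvdn_odd (pdiv_dvd t) ot.
  exact: dvdn_trans (pdiv_dvd t) dvt.
case: (boolP (odd r)) => [or | er].
  have [r1 | r1] : (r = 1 \/ 1 < r)%N by lia.
    by exists b^-1; [exact: Ffield_inv | rewrite Eu r1 exprVn mul1r].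
  exact: (odd_case r).
have [r2 | r2] : (r = 2 \/ 2 < r)%N by move: r0 er n4; clear; lia.
  have [t Ft t2] := sqrt2_Ffield hs.
  by exists (t / b); [exact: Ffield_div | rewrite Eu r2 expr_div_n t2].
by apply: (odd_case r./2); [apply/dvdnP; exists 2%N|..]; move: r0 er n4 r2; clear; lia.
Qed.

(** Scaling [b] by the denominator of [r] clears it without changing the class of [u] modulo
    squares. *)
Lemma scale_rat_sqr u b r : r \in Crat -> u * b ^+ 2 = r ->
  exists d : int, exists c : int, d != 0 /\ u * (d%:~R * b) ^+ 2 = c%:~R.
Proof.
case/CratP=> a -> E; exists (denq a), (numq a * denq a).
have nz : (denq a)%:~R != 0 :> algC by rewrite intr_eq0 denq_neq0.
have Ea : ratr a = (numq a)%:~R / (denq a)%:~R :> algC by [].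
have Ec : (numq a * denq a)%:~R = ratr a * (denq a)%:~R ^+ 2 :> algC.
  by rewrite Ea intrM; field.
split; rewrite ?denq_neq0 //.
by rewrite Ec -E; ring.
Qed.

Lemma unit_Ffield_square_rat u b r : F u -> u \in Aint -> u^-1 \in Aint -> 0 < u ->
  F b -> b != 0 -> r \in Crat -> u * b ^+ 2 = r -> Fsquare u.
Proof.
move=> Fu Au Au' u0 Fb b0 Qr Er; have [d [c [d0 Ec]]] := scale_rat_sqr Qr Er.
have Fdb : F (d%:~R * b) by apply: subringM => //; exact: subring_int.
have cpos : 0 < c%:~R :> algC.
  rewrite -Ec pmulr_rgt0 // -real_normK ?(Ffield_real hs) //.
  by rewrite exprn_gt0 // normr_gt0 mulf_neq0 // intr_eq0.
have [c' Dc] : exists c' : nat, c = c' by exists `|c|%N; move: cpos; rewrite ltr0z; lia.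
apply: (@unit_Ffield_square_nat u (d%:~R * b) c') => //.
- by rewrite gt_eqF.
- by move: cpos; rewrite Dc ltr0z.
- by rewrite Ec Dc.
Qed.

Lemma pgen_Ffield : F p.
Proof. exact/Ounder_Ffield/Ounder_pgen. Qed.

Lemma unit_pgen_not_rat_square u b r : F u -> u \in Aint -> u^-1 \in Aint -> u != 0 ->
  F b -> b != 0 -> r \in Crat -> u * p * b ^+ 2 = r -> False.
Proof.
move=> Fu Au Au' u0 Fb b0 Qr Er; have [d [c [d0 Ec]]] := scale_rat_sqr Qr Er.
have p0 := pgen_neq0 hs; have Fp := pgen_Ffield.
have : F (d%:~R * b) by apply: subringM => //; exact: subring_int.
have : d%:~R * b != 0 by rewrite mulf_neq0 // intr_eq0.
move: (d%:~R * b) Ec => {d d0 Fb b0 Er r Qr b} b Ec b0 Fb.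
(* Infinite descent on [|c|] replaces the valuation argument: [c] turns out to be even, and dividing
   [b] by a square root of 2 in F halves it. *)
have [k] := ubnP `|c|%N; elim: k c b Ec b0 Fb => // k IH c b Ec b0 Fb ltc.
have c0 : c != 0 by rewrite -(intr_eq0 algC) -Ec !mulf_neq0 ?expf_neq0.
have [c' Dc] : exists c', c = c' * 2.
  apply: (pgen_dvd_int hs).
  have Epb : (p * b) ^+ 2 / p = c%:~R * u^-1 by rewrite -Ec; field; rewrite p0 u0.
  have Opb : O (p * b).
    apply: (ring_of_integers_Ffield hs); first exact: subringM.
    apply: (@Aint_root 2) => //; rewrite -(divfK p0 (_ ^+ 2)) Epb !rpredM ?Aint_int //.
    exact/(Ounder_Aint hs)/Ounder_pgen.
  have : O (p * b / p).
    by apply: (pgen_dvd_sqr hs) => //; rewrite Epb rpredM ?Aint_int.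
  move/(Ounder_Aint hs); rewrite mulrAC divff // mul1r => Ab.
  by rewrite -Ec mulrAC mulfK // rpredM ?rpredX.
have [t Ft t2] := sqrt2_Ffield hs.
have t0 : t != 0 by apply/eqP => E; move/eqP: t2; rewrite E expr0n eq_sym pnatr_eq0.
apply: (IH c' (b / t)).
- rewrite expr_div_n t2 mulrA Ec Dc intrM -[2%:~R]/(2%:R) mulfK // pnatr_eq0 //.
- by rewrite mulf_neq0 ?invr_eq0.
- exact: Ffield_div.
- by move: ltc c0; rewrite Dc; lia.
Qed.

Lemma weber_invariant u eta : F u -> u \in Aint -> u^-1 \in Aint -> 0 < u ->
  F eta -> sg 1 u = u * eta ^+ 2 -> Fsquare u.
Proof.
move=> Fu Au Au' up Fe Eu; have u0 : u != 0 by rewrite gt_eqF.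
(* The squared partial norms of [eta] telescope, so its full norm is 1 or -1. *)
have sq t : (\prod_(j < t) sg j eta) ^+ 2 = sg t u / u.
  elim: t => [|t IHt]; first by rewrite big_ord0 expr1n sg0 // divff.
  rewrite big_ord_recr /= exprMn IHt -[t.+1]addn1 -sg_comp // Eu rmorphM rmorphXn /=.
  by rewrite mulrAC.
have N2 : (\prod_(j < m) sg j eta) ^+ 2 = 1 by rewrite sq sgm // divff.
have /orP[/eqP N | /eqP N] : (\prod_(j < m) sg j eta == 1) || (\prod_(j < m) sg j eta == -1).
  by rewrite -sqrf_eq1 N2.
  have [b [Fb b0 Eb]] := hilbert90 Fe N.
  apply: (unit_Ffield_square_rat Fu Au Au' up Fb b0 _ (erefl _)).
  have Fr : F (u * b ^+ 2) by apply: subringM => //; exact: subringX.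
  apply: sg_fixed_rat => //.
  by rewrite rmorphM rmorphXn /= Eu -mulrA -exprMn -Eb.
(* For norm -1, the factor [eta0], also of norm -1, restores norm 1 at the cost of replacing [u] by
   [u p]. *)
have F0 := eta0_Ffield; have Fee : F (eta * eta0) by exact: subringM.
have [|b [Fb b0 Eb]] := hilbert90 Fee.
  under eq_bigr do rewrite rmorphM; rewrite big_split /= N norm_eta0; ring.
exfalso; apply: (unit_pgen_not_rat_square Fu Au Au' u0 Fb b0 _ (erefl _)).
have Fp := pgen_Ffield.
have Fr : F (u * p * b ^+ 2) by apply: subringM => //; [exact: subringM|exact: subringX].
apply: sg_fixed_rat => //.
rewrite 2!rmorphM rmorphXn /= Eu sg_pgen [in RHS]Eb; ring.
Qed.

(* Gal(F/Q) is a 2-group acting on the F_2-vector space of totally positive units modulo squares,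
   so it suffices to treat invariant classes; we climb the filtration by the powers of sigma. *)
Lemma totally_positive_unit_square u : F u -> u \in Aint -> u^-1 \in Aint ->
  (forall tau : {rmorphism algC -> algC}, 0 < tau u) -> Fsquare u.
Proof.
move=> Fu Au Au' up.
suff step k : forall u, F u -> u \in Aint -> u^-1 \in Aint ->
    (forall tau : {rmorphism algC -> algC}, 0 < tau u) -> Fsquare (sg (2 ^ k) u / u) -> Fsquare u.
  apply: (step (s - 2)%N) => //; exists 1; first exact: subring1.
  by rewrite sgm // divff ?expr1n // gt_eqF // (up idfun).
elim: k {u Fu Au Au' up} => [|k IH] u Fu Au Au' up [c Fc Ec].
  have u0 : 0 < u by exact: (up idfun).
  apply: (@weber_invariant u c) => //; rewrite -Ec mulrCA divff ?mulr1 // gt_eqF //.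
have u0 : u != 0 by rewrite gt_eqF // (up idfun).
have s0 : sg (2 ^ k) u != 0 by rewrite fmorph_eq0.
(* The induction hypothesis serves twice: first for [u], then for [v = sg (2^k) u / u]. Modulo
   squares, [sg (2^k) v / v] is [sg (2^(k+1)) u / u]. *)
apply: (IH) => //; apply: (IH).
- by apply: Ffield_div => //; exact: sg_Ffield.
- by rewrite rpredM // Aint_aut.
- by rewrite invf_div rpredM // -fmorphV Aint_aut.
- move=> tau; rewrite rmorphM fmorphV /= divr_gt0 ?up //.
  exact: (up (tau \o sg (2 ^ k) : {rmorphism algC -> algC})).
- exists (c * u / sg (2 ^ k) u).
    by apply: Ffield_div; [exact: subringM|exact: sg_Ffield].
  rewrite rmorphM fmorphV /= sg_comp // addnn -mul2n -expnS.
  rewrite !exprMn -Ec exprVn; field; by rewrite s0 u0.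
Qed.

End Weber.

(** * Totally complex quadratic extensions of F *)

(** Shifting by [n] encodes the interval from [-n] to [n] injectively; the bounds keep [inord] away
    from its default value. *)
Lemma bounded_int_code (n : nat) (a b : int) : (`|a| <= n)%N -> (`|b| <= n)%N ->
  @inord n.*2 `|(a + n%:Z)%R|%N = @inord n.*2 `|(b + n%:Z)%R|%N :> nat -> a = b.
Proof. by move=> la lb; rewrite !inordK; lia. Qed.

Section Quadratic.
Variables (s : nat) (hs : (3 <= s)%N) (L : algC -> Prop).
Local Notation z := (zeta s).
Local Notation O := (Ounder s).
Local Notation F := (Ffield s).
Local Notation K := (Kfield s).
Local Notation p := (pgen s).
Local Notation m := (2 ^ (s - 2))%N.
Let hO := Ounder_subring s.
Let hF := Ffield_subring s.
Hypotheses (hL : is_subfield L) (FL : subset_of F L).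

Lemma subfield_subring : is_subring L.
Proof. by case: hL. Qed.
Let hLr := subfield_subring.

Lemma subfieldV x : L x -> L x^-1.
Proof. by case: hL => _ _ _ _; apply. Qed.

Lemma subfield_div x y : L x -> L y -> L (x / y).
Proof. by move=> Lx Ly; apply: subringM => //; exact: subfieldV. Qed.

Lemma quadratic_span y : degree2_over F L -> L y -> ~ F y ->
  forall x, L x -> exists a b, [/\ F a, F b & x = a + b * y].
Proof.
case=> e1 [e2 [Le1 Le2 span]] Ly nFy.
have coords x : L x -> exists a b, [/\ F a, F b & x = a * e1 + b * e2].
  by move=> /span[[a b] [[/= Fa Fb ->] _]]; exists a, b.
have [a1 [a2 [Fa1 Fa2 E1]]] := coords 1 (subring1 hLr).
have [b1 [b2 [Fb1 Fb2 Ey]]] := coords y Ly.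
have FD : F (a1 * b2 - a2 * b1) by apply: subringB => //; exact: subringM.
(* If the determinant of the coordinates of 1 and [y] vanished, [y] would lie in F; otherwise
   Cramer's rule gives the new coordinates. *)
have [D0 | nD0] := eqVneq (a1 * b2 - a2 * b1) 0.
  have Ea1 : a1 * y = b1.
    rewrite -[RHS]mulr1 E1 Ey; apply/eqP; rewrite -subr_eq0; apply/eqP.
    transitivity ((a1 * b2 - a2 * b1) * e2); [by ring | by rewrite D0 mul0r].
  have Ea2 : a2 * y = b2.
    rewrite -[RHS]mulr1 E1 Ey; apply/eqP; rewrite -subr_eq0; apply/eqP.
    transitivity (- (a1 * b2 - a2 * b1) * e1); [by ring | by rewrite D0 oppr0 mul0r].
  case: nFy; have [a10 | a10] := eqVneq a1 0.
    have [a20 | a20] := eqVneq a2 0.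
      by move/eqP: E1; rewrite a10 a20 !mul0r addr0 oner_eq0.
    by rewrite (_ : y = b2 / a2); [exact: Ffield_div | rewrite -Ea2 mulrAC divff ?mul1r].
  by rewrite (_ : y = b1 / a1); [exact: Ffield_div | rewrite -Ea1 mulrAC divff ?mul1r].
move=> x /coords[c1 [c2 [Fc1 Fc2 ->]]].
exists ((c1 * b2 - c2 * b1) / (a1 * b2 - a2 * b1)), ((a1 * c2 - a2 * c1) / (a1 * b2 - a2 * b1)).
split; try by apply: Ffield_div => //; apply: subringB => //; exact: subringM.
rewrite -[X in _ = X + _]mulr1 E1 Ey; field; exact: nD0.
Qed.

(** Completing the square in [y^2 = a + b y] gives [d = 2 y - b] with square in F. Each [tau d] has
    a real square and is not real, hence is purely imaginary. *)
Lemma quadratic_imaginary_generator : degree2_over F L -> totally_complex L ->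
  exists d, [/\ L d, forall tau : {rmorphism algC -> algC}, (tau d)^* = - tau d
    & forall x, L x -> exists a b, [/\ F a, F b & x = a + b * d]].
Proof.
move=> h2 tc; have [y [Ly /= nry]] := tc idfun.
have nFy : ~ F y by move=> /(Ffield_real hs); rewrite (negPf nry).
have spany := quadratic_span h2 Ly nFy.
have [a [b [Fa Fb Ey2]]] := spany _ (subringX hLr 2 Ly).
pose d := 2 * y - b.
have F2 : F 2 by exact: (subring_nat hF 2).
have Fd2 : F (d ^+ 2).
  have -> : d ^+ 2 = b ^+ 2 + 4 * a by rewrite /d sqrrB exprMn Ey2; ring.
  apply: subringD => //; first exact: subringX.
  by apply: subringM => //; exact: (subring_nat hF 4).
have Ld : L d by apply: subringB => //; [apply: subringM|]; rewrite //; exact: FL.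
have spand x : L x -> exists a b, [/\ F a, F b & x = a + b * d].
  move=> /spany[a' [b' [Fa' Fb' ->]]]; exists (a' + b' * b / 2), (b' / 2).
  have Fb2 : F (b' / 2) by exact: Ffield_div.
  split=> //; last by rewrite /d; field.
  by apply: subringD => //; rewrite mulrAC; exact: subringM.
have nrd (tau : {rmorphism algC -> algC}) : tau d \isn't Num.real.
  have [x [Lx]] := tc tau; apply: contra => rd.
  have [a' [b' [Fa' Fb' ->]]] := spand x Lx.
  have rF y' : F y' -> tau y' \is Num.real.
    by move=> Fy'; apply: (Ffield_real hs); exact: Ffield_aut.
  rewrite rmorphD rmorphM /=; apply: realD; [exact: rF|apply: realM; [exact: rF|exact: rd]].
exists d; split=> // tau.
have /eqP : (tau d)^* ^+ 2 = tau d ^+ 2.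
  have : (tau (d ^+ 2))^* = tau (d ^+ 2) by apply: (Ffield_conj hs); exact: Ffield_aut.
  by rewrite !rmorphXn.
rewrite eqf_sqr => /orP[/eqP/CrealP | /eqP //].
by rewrite (negPf (nrd tau)).
Qed.

(** * Complex conjugation on L and roots of unity *)

Variable d : algC.
Hypothesis Ld : L d.
Hypothesis conj_aut_d : forall tau : {rmorphism algC -> algC}, (tau d)^* = - tau d.
Hypothesis spand : forall x, L x -> exists a b, [/\ F a, F b & x = a + b * d].

Lemma conj_d : d^* = - d. Proof. exact: (conj_aut_d idfun). Qed.

Lemma cm_conj x : L x -> L x^*.
Proof.
move=> /spand[a [b [Fa Fb ->]]].
rewrite rmorphD rmorphM /= conj_d !(Ffield_conj hs) //.
apply: subringD => //; first exact: FL.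
by apply: subringM => //; [exact: FL | exact: subringN].
Qed.

Lemma cm_real x : L x -> x^* = x -> F x.
Proof.
move=> /spand[a [b [Fa Fb ->]]]; rewrite rmorphD rmorphM /= conj_d !(Ffield_conj hs) //.
move/addrI; rewrite mulrN => /eqP; rewrite eq_sym -addr_eq0 -mulr2n mulrn_eq0 /= => /eqP ->.
by rewrite addr0.
Qed.

Lemma cm_conj_aut (tau : {rmorphism algC -> algC}) x : L x -> tau x^* = (tau x)^*.
Proof.
move=> /spand[a [b [Fa Fb ->]]]; rewrite [in LHS]rmorphD [in LHS]rmorphM /= conj_d.
rewrite (Ffield_conj hs Fa) (Ffield_conj hs Fb) !rmorphD !rmorphM /= rmorphN conj_aut_d.
by rewrite !(Ffield_conj hs) //; exact: Ffield_aut.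
Qed.

(** A nonzero number is determined up to inversion by its sum with its inverse. *)
Lemma root_of_unity_eq_trace (w : algC) k l : w != 0 ->
  w ^+ k + w ^- k = w ^+ l + w ^- l -> w ^+ k = w ^+ l \/ w ^+ (k + l) = 1.
Proof.
move=> w0 E; have : (w ^+ k - w ^+ l) * (w ^+ (k + l) - 1) = 0.
  have -> : (w ^+ k - w ^+ l) * (w ^+ (k + l) - 1)
    = w ^+ (k + l) * ((w ^+ k + w ^- k) - (w ^+ l + w ^- l)).
    by rewrite exprD; field; rewrite !expf_neq0.
  by rewrite E subrr mulr0.
by move/eqP; rewrite mulf_eq0 !subr_eq0 => /orP[/eqP|/eqP]; [left|right].
Qed.

(* Kronecker's theorem. The traces [w^k + w^-k] lie in O and have all conjugates bounded by 2, so
   their trace coordinates take finitely many values and two of them agree. *)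
Lemma cm_root_of_unity w : L w -> w \in Aint -> w * w^* = 1 -> exists2 k, (0 < k)%N & w ^+ k = 1.
Proof.
move=> Lw Aw ww.
have w0 : w != 0 by apply: contraTneq isT => E; move/eqP: ww; rewrite E mul0r eq_sym oner_eq0.
have wV : w^* = w^-1 by apply: (mulfI w0); rewrite ww divff.
have n1 (tau : {rmorphism algC -> algC}) : `|tau w| = 1.
  apply/eqP; rewrite -(@pexpr_eq1 _ _ 2) // normCK -cm_conj_aut // -rmorphM /= ww.
  by rewrite rmorph1.
pose t k := w ^+ k + w ^- k.
have Ft k : F (t k).
  have Et : t k = w ^+ k + (w ^+ k)^* by rewrite rmorphXn /= wV exprVn.
  apply: cm_real; rewrite Et.
    by apply: subringD => //; [|apply: cm_conj]; exact: subringX.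
  by rewrite rmorphD /= conjCK addrC.
have At k : t k \in Aint.
  by rewrite rpredD ?rpredX // -exprVn -wV rpredX // (Aint_aut Num.conj).
have Bt (tau : {rmorphism algC -> algC}) k : `|tau (t k)| <= 2.
  rewrite rmorphD fmorphV rmorphXn /=; apply: le_trans (ler_normD _ _) _.
  by rewrite normfV !normrX n1 expr1n invr1.
pose n := (2 ^ s)%N.
pose c k i : int := Num.floor (cyclo_trace s (t k * z ^- i)).
have cE k i : cyclo_trace s (t k * z ^- i) = (c k i)%:~R.
  have [e De] := tr_coord_int hs i (Ffield_Kfield (Ft k)) (At k).
  by rewrite /c De intrKfloor.
(* The trace has n/2 terms, each of absolute value at most 2. *)
have cB k i : (`|c k i| <= n)%N.
  have : `|cyclo_trace s (t k * z ^- i)| <= n%:R.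
    apply: le_trans (ler_norm_sum _ _ _) _.
    have -> : n%:R = \sum_(j < 2 ^ s.-1) 2 :> algC.
      rewrite sumr_const card_ord -mulrnA -expnS prednK //; lia.
    apply: ler_sum => j _; rewrite rmorphM normrM oddaut_zetaV // normfV normrX.
    rewrite (@unity_root_norm1 (2 ^ s) z) ?zetaXn ?expn_gt0 // expr1n invr1 mulr1.
    exact: Bt.
  by rewrite cE -intr_norm -[n%:R]/(n%:~R) ler_int; lia.
pose code k : {ffun 'I_n -> 'I_(n.*2.+1)} := 
  [ffun i : 'I_n => inord `|(c k i + n%:Z)%R|%N].
have codeP k l : code k = code l -> t k = t l.
  move=> E; have nz : n%:R != 0 :> algC by rewrite pnatr_eq0 -lt0n expn_gt0.
  apply: (mulfI nz); rewrite !(tr_inversion hs (Ffield_Kfield (Ft _))).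
  apply: eq_bigr => i _; rewrite !cE; congr (_%:~R * _).
  have := congr1 (fun f : {ffun 'I_n -> 'I_(n.*2.+1)} => nat_of_ord (f i)) E; rewrite !ffunE.
  exact: bounded_int_code.
pose N := #|{ffun 'I_n -> 'I_(n.*2.+1)}|.
have : ~~ injectiveb (fun k : 'I_N.+1 => code k).
  by apply/negP => /injectiveP/leq_card; rewrite card_ord ltnn.
case/injectivePn => k [l nkl /codeP/root_of_unity_eq_trace[]] //.
  wlog ltkl : k l nkl / (k < l)%N => [wl E|].
    have : (nat_of_ord k != l) by [].
    rewrite neq_ltn => /orP[lt|lt]; first exact: (wl k l).
    by apply: (wl l k) => //; rewrite eq_sym.
  move=> E; exists (l - k)%N; first by rewrite subn_gt0.
  have wk : w ^+ k != 0 by rewrite expf_neq0.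
  by apply: (mulfI wk); rewrite -exprD subnKC 1?ltnW // mulr1.
move=> E; exists (k + l)%N => //; rewrite lt0n addn_eq0; apply/negP => /andP[/eqP k0 /eqP l0].
by case/negP: nkl; apply/eqP/val_inj; rewrite /= k0 l0.
Qed.

(** [i = z ^ (n/4)] lies in L, and [i] times [thetak] at [n/4 - 1] is [z - 1/z], which with [theta]
    recovers [z]. Conversely [z = a + b d] is not real, so [b] is nonzero and [d] lies in K. *)
Lemma imaginary_unit_cm x : L x -> x ^+ 2 = -1 -> same_set L K.
Proof.
move=> Lx x2; pose i0 := z ^+ m.
have z0 := zeta_neq0 hs; have hK := Kfield_subring s.
have i2 : i0 ^+ 2 = -1.
  by rewrite -exprM -expnSr (_ : (s - 2).+1 = s.-1) ?zetaXhalf //; lia.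
have i00 : i0 != 0 by rewrite expf_neq0.
have Li : L i0.
  have : i0 ^+ 2 == x ^+ 2 by rewrite i2 x2.
  by rewrite eqf_sqr => /orP[/eqP-> | /eqP->] //; exact: subringN.
have Lz : L z.
  have E : z = (theta s + i0 * thetak s m.-1) / 2.
    have Em : z ^+ m.-1 = i0 / z.
      by apply: (mulIf z0); rewrite divfK // -exprSr prednK // expn_gt0.
    have -> : i0 * thetak s m.-1 = z - z^-1.
      rewrite /thetak Em mulrDr mulrA -expr2 i2; field; by rewrite z0 i00.
    by rewrite /theta; field.
  rewrite E; apply: subfield_div; last exact: (subring_nat hLr 2).
  apply: subringD => //; first by apply/FL/Ounder_Ffield/Ounder_theta.
  by apply: subringM => //; apply/FL/Ffield_thetak.
move=> y; split; last first.
  by apply: Kfield_sub => // a; apply/FL/Ffield_rat.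
have Kd : K d.
  have [a [b [Fa Fb Ez]]] := spand Lz.
  have [b0 | b0] := eqVneq b 0.
    have : z ^+ 2 == 1.
      have zr : z^* = z by rewrite Ez b0 mul0r addr0 (Ffield_conj hs).
      by rewrite expr2 -{1}zr zeta_conj // mulVf.
    rewrite -(prim_order_dvd (zeta_prim hs)) => /dvdn_leq => /(_ isT).
    by rewrite -[X in (_ <= X)%N -> _]expn1 leq_exp2l //; lia.
  have -> : d = (z - a) * b^-1 by rewrite Ez addrC addKr mulrAC divff ?mul1r.
  apply: subringM => //; last exact/Kfield_inv/Ffield_Kfield.
  by apply: subringB => //; [exact: Kfield_zeta | exact: Ffield_Kfield].
move=> /spand[a [b [Fa Fb ->]]].
by apply: subringD => //; [|apply: subringM => //]; exact: Ffield_Kfield.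
Qed.

(** [y / c] is a square root of [- p] in L, hence [e] up to sign. Each [x] is then the sum of its
    real part and a real multiple of [e], and the real elements of L form F. *)
Lemma cm_Fsqrt y c : L y -> y^* = - y -> F c -> c != 0 -> y ^+ 2 = - p * c ^+ 2 ->
  same_set L (Fsqrt s).
Proof.
move=> Ly yc Fc c0 y2; pose e := sqrtC (- p).
have e2 : e ^+ 2 = - p by exact: sqrtCK.
have e0 : e != 0.
  by apply: contra_neq (pgen_neq0 hs) => E; apply: oppr_inj; rewrite -e2 E expr0n oppr0.
have [Le ec] : L e /\ e^* = - e.
  have L1 : L (y / c) by apply: subfield_div => //; exact: FL.
  have C1 : (y / c)^* = - (y / c) by rewrite rmorphM fmorphV /= yc (Ffield_conj hs Fc) mulNr.
  have : e ^+ 2 == (y / c) ^+ 2 by rewrite e2 expr_div_n y2 mulfK // expf_neq0.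
  rewrite eqf_sqr => /orP[/eqP-> | /eqP->] //.
  by split; [exact: subringN | rewrite rmorphN /= C1].
move=> x; split; last exact: sub_adjoin.
move=> Lx; have Lxc := cm_conj Lx.
change (adjoin F e x); have hA : is_subring (adjoin F e) by exact: adjoin_subring.
have Fa : F ((x + x^*) / 2).
  apply: cm_real; first by apply: subfield_div; [exact: subringD | exact: (subring_nat hLr 2)].
  by rewrite rmorphM rmorphD fmorphV rmorph_nat /= conjCK addrC.
have Fb : F ((x - x^*) / (2 * e)).
  apply: cm_real.
    apply: subfield_div; first exact: subringB.
    by apply: subringM => //; exact: (subring_nat hLr 2).
  rewrite rmorphM rmorphB fmorphV rmorphM rmorph_nat /= conjCK ec.
  by rewrite mulrN invrN mulrN -mulNr opprB.
have -> : x = (x + x^*) / 2 + (x - x^*) / (2 * e) * e by field.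
apply: subringD => //; first exact: adjoin_const.
by apply: subringM => //; [exact: adjoin_const | exact: adjoin_gen].
Qed.

Lemma pow2_root_of_unity (y : algC) a : y ^+ (2 ^ a) = 1 ->
  [\/ y = 1, y = -1 | exists j, (y ^+ j) ^+ 2 = -1].
Proof.
elim: a y => [|a IH] y; first by rewrite expr1 => ->; constructor 1.
rewrite expnS exprM => /IH[/eqP | y2 | [j Dj]].
- by rewrite sqrf_eq1 => /orP[/eqP-> | /eqP->]; [constructor 1|constructor 2].
- by constructor 3; exists 1%N; rewrite expr1.
- by constructor 3; exists (2 * j)%N; rewrite exprM.
Qed.

(** [1 - y] divides [1 - y ^+ 2], and repeated squaring ends at [y = -1], where [1 - y = 2]. *)
Lemma pow2_root_of_unity_dvd2 (y : algC) a : y \in Aint -> y != 1 -> y ^+ (2 ^ a) = 1 ->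
  2 / (1 - y) \in Aint.
Proof.
elim: a y => [|a IH] y Ay ny1; first by rewrite expr1 => E; rewrite E eqxx in ny1.
rewrite expnS exprM => Ey.
have [y2 | ny2] := eqVneq (y ^+ 2) 1.
  have : y ^+ 2 == 1 by apply/eqP.
  rewrite sqrf_eq1 (negPf ny1) => /eqP->.
  by rewrite opprK -(natrD _ 1 1) divff ?rpred1 // pnatr_eq0.
have := IH _ (rpredX _ Ay) ny2 Ey.
have nz1 : 1 - y != 0 by rewrite subr_eq0 eq_sym.
have nz2 : 1 - y ^+ 2 != 0 by rewrite subr_eq0 eq_sym.
have -> : 2 / (1 - y) = 2 / (1 - y ^+ 2) * (1 + y).
  by field; rewrite nz1 nz2.
by move=> A2; rewrite rpredM // rpredD.
Qed.

(** A real [q] would lie in O, so [p] would divide [q]; as [q ^+ 2] is associate to [p], this would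
    make [p] a unit. *)
Lemma assoc_not_real q : L q -> q \in Aint -> q != 0 -> q ^+ 2 / p \in Aint ->
  p / q ^+ 2 \in Aint -> q^* != q.
Proof.
move=> Lq Aq q0 Aqp Apq; have p0 := pgen_neq0 hs.
apply/eqP => /(cm_real Lq) Fq; have Oq := ring_of_integers_Ffield hs Fq Aq.
case/negP: (pgen_not_unit hs).
have -> : p^-1 = p / q ^+ 2 * (q / p) ^+ 2 by field; rewrite p0 q0.
by rewrite rpredM // rpredX // (Ounder_Aint hs) //; exact: pgen_dvd_sqr.
Qed.

(* [L] lies in the field of [2^(s+1)]-th roots of unity, which is fixed by an automorphism
   squaring the roots of unity of odd order. *)
Lemma odd_root_of_unity_trivial v N : same_set L K \/ same_set L (Fsqrt s) ->
  L v -> odd N -> v ^+ N = 1 -> v = 1.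
Proof.
move=> cl Lv oN vN; pose M := (2 ^ s.+1)%N; pose k := chinese M N 1 2.
have cMN : coprime M N by rewrite coprimeXl // coprime2n.
have kM : k = 1 %[mod M] by exact: chinese_modl.
have kN : k = 2 %[mod N] by exact: chinese_modr.
have ck : coprime k (M * N).
  rewrite coprimeMr -coprime_modl kM coprime_modl coprime1n /=.
  by rewrite -coprime_modl kN coprime_modl coprime2n.
have [tau Dtau] := Qn_aut_exists ck.
have fixM x : x ^+ M = 1 -> tau x = x.
  move=> xM; rewrite Dtau; last by rewrite exprM xM expr1n.
  by rewrite -(expr_mod k xM) kM expr_mod ?expr1.
have z0 := zeta_neq0 hs.
have Ez : tau z = z by apply: fixM; rewrite /M expnSr exprM zetaXn // expr1n.
pose R x := tau x = x.
have hR : is_subring R.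
  by split=> [|x y|x y]; rewrite /R ?rmorph1 ?rmorphB ?rmorphM //= => -> ->.
have KR x : K x -> R x by apply: Kfield_sub => // a; exact: fmorph_rat.
have Re : R (sqrtC (- p)).
  pose y := sqrtC z; have y2 : y ^+ 2 = z by exact: sqrtCK.
  have Ry : R y by apply: fixM; rewrite /M expnS exprM y2 zetaXn.
  (* Up to sign, [i z^(-1/2) (1 + z)] is the square root of [- p], because [p = z^-1 (1 + z)^2]. *)
  pose e := z ^+ m * (y^-1 * (1 + z)).
  have Re : R e.
    apply: subringM => //; first exact: subringX.
    apply: subringM => //; first by rewrite /R fmorphV /= Ry.
    by apply: subringD => //; exact: subring1.
  have : sqrtC (- p) ^+ 2 == e ^+ 2.
    rewrite sqrtCK /e !exprMn exprVn y2 -pgenE // -exprM -expnSr.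
    by rewrite (_ : (s - 2).+1 = s.-1) ?zetaXhalf ?mulN1r //; lia.
  by rewrite eqf_sqr => /orP[/eqP-> | /eqP->] //; exact: subringN.
have : R v.
  case: cl => cl; have := Lv; rewrite cl => Cv; first exact: KR.
  by apply: sub_adjoin Cv => // x /Ffield_Kfield/KR.
rewrite /R Dtau; last by rewrite mulnC exprM vN expr1n.
rewrite -(expr_mod k vN) kN expr_mod // expr2.
have v0 : v != 0.
  have N0 : N != 0%N by apply: contraTneq oN => ->.
  by apply: contra_eq_neq vN => ->; rewrite expr0n (negPf N0) eq_sym oner_eq0.
by rewrite -{3}[v]mulr1 => /(mulfI v0).
Qed.

(** * Elements of L whose square is associate to [p] *)

Section AssociateSquare.
Variable q : algC.
Hypotheses (Lq : L q) (Aq : q \in Aint) (q0 : q != 0).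
Hypotheses (Aqp : q ^+ 2 / p \in Aint) (Apq : p / q ^+ 2 \in Aint).

Let p0 := pgen_neq0 hs.
Let Fp : F p. Proof. exact: pgen_Ffield. Qed.
Let pc : p^* = p. Proof. exact: (Ffield_conj hs). Qed.
Let qc0 : q^* != 0. Proof. by rewrite conjC_eq0. Qed.

Local Notation w := (q^* / q).

Lemma conj_quotient : [/\ L w, w \in Aint & w * w^* = 1].
Proof.
have Aqc : q^* ^+ 2 / p \in Aint.
  by move: Aqp; rewrite -(Aint_aut Num.conj) rmorphM fmorphV rmorphXn /= pc.
split; first by apply: subfield_div => //; exact: cm_conj.
  apply: (@Aint_root 2) => //.
  have -> : w ^+ 2 = q^* ^+ 2 / p * (p / q ^+ 2) by field; rewrite p0 q0.
  by rewrite rpredM.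
by rewrite rmorphM fmorphV /= conjCK; field; rewrite q0 qc0.
Qed.

Lemma conj_quotient_root : exists a, exists2 N, odd N & w ^+ (2 ^ a * N) = 1.
Proof.
have [Lw Aw ww] := conj_quotient.
have [k k0 wk] := cm_root_of_unity Lw Aw ww.
have [N cN Dk] := pfactor_coprime (isT : prime 2) k0; rewrite coprime2n in cN.
by exists (logn 2 k), N; rewrite // mulnC -Dk.
Qed.

Lemma cm_classification : same_set L K \/ same_set L (Fsqrt s).
Proof.
have [Lw Aw ww] := conj_quotient; have [a [N oN wN]] := conj_quotient_root.
have w0 : w != 0 by rewrite mulf_neq0 ?invr_eq0.
have : (w ^+ N) ^+ (2 ^ a) = 1 by rewrite -exprM mulnC.
(* [w = eps * v ^+ 2] with [eps = w ^+ N] a sign, so that [q * v] is real or purely imaginary. *)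
pose v := (w ^+ N * w) ^+ (N.+1)./2.
have EN : N.+1 = ((N.+1)./2 * 2)%N by lia.
have Lv : L v by apply: subringX => //; apply: subringM => //; exact: subringX.
have v0 : v != 0 by rewrite expf_neq0 // mulf_neq0 ?expf_neq0.
have n1 : `|w| = 1 by apply/eqP; rewrite -(@pexpr_eq1 _ _ 2) // normCK ww.
have vc : v^* = v^-1.
  by apply: conj_norm1; rewrite normrX normrM normrX n1 !expr1n mulr1 expr1n.
have Av : v \in Aint by rewrite rpredX // rpredM // rpredX.
have AvV : v^-1 \in Aint by rewrite -vc (Aint_aut Num.conj).
have conjqv eps : w ^+ N = eps -> eps ^+ 2 = 1 -> (q * v)^* = eps * (q * v).
  move=> E E2; have v2 : v ^+ 2 = eps * w.
    by rewrite /v -exprM -EN E exprMn {1}EN mulnC exprM E2 expr1n mul1r exprSr E.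
  rewrite rmorphM /= vc; apply: (mulIf v0); rewrite divfK // -!mulrA -expr2 v2.
  have -> : eps * (q * (eps * w)) = eps ^+ 2 * (w * q) by ring.
  by rewrite E2 mul1r divfK.
have Lqv : L (q * v) by exact: subringM.
have Aqv : q * v \in Aint by rewrite rpredM.
have qv0 : q * v != 0 by rewrite mulf_neq0.
move=> /pow2_root_of_unity[E | E | [j Ej]]; last first.
- by left; apply: (imaginary_unit_cm (x := (w ^+ N) ^+ j)) => //; do 2 apply: subringX => //.
- right; have Eqv := conjqv _ E (sqrr_sign _ 1); rewrite mulN1r in Eqv.
  pose u := - (q * v) ^+ 2 / p.
  have Fu : F u.
    apply: cm_real.
      by apply: subfield_div => //; [apply: subringN => //; exact: subringX | exact: FL].
    by rewrite /u rmorphM rmorphN rmorphXn fmorphV /= Eqv sqrrN pc.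
  have Au : u \in Aint by rewrite /u mulNr exprMn mulrAC rpredN rpredM // rpredX.
  have Au' : u^-1 \in Aint.
    have -> : u^-1 = - (p / q ^+ 2 * v^-1 ^+ 2) by rewrite /u; field; rewrite p0 q0 v0.
    by rewrite rpredN rpredM // rpredX.
  (* Both parts are squared absolute values: [- (q v)^2] maps to that of [tau (q v)], and [p] to
     that of [1 + tau z]. *)
  have up (tau : {rmorphism algC -> algC}) : 0 < tau u.
    have Et := cm_conj_aut tau Lqv; rewrite Eqv rmorphN /= in Et.
    rewrite /u rmorphM fmorphV rmorphN rmorphXn /= divr_gt0 //.
      rewrite expr2 -mulrN Et -normCK exprn_gt0 // normr_gt0 fmorph_eq0 //.
    have y1 : `|tau z| = 1.
      by rewrite (@unity_root_norm1 (2 ^ s)) ?expn_gt0 // -rmorphXn /= zetaXn // rmorph1.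
    have -> : tau p = (1 + tau z) * (1 + tau z)^*.
      have y0 : tau z != 0 by rewrite fmorph_eq0 zeta_neq0.
      rewrite pgenE // rmorphD rmorph1 /= (conj_norm1 y1) rmorphM fmorphV rmorphXn rmorphD rmorph1 /=.
      by field.
    rewrite -normCK exprn_gt0 // normr_gt0 -[1](rmorph1 tau) -rmorphD fmorph_eq0.
    exact: oneDzeta_neq0.
  have [c Fc Ec] := totally_positive_unit_square hs Fu Au Au' up.
  apply: (cm_Fsqrt Lqv Eqv Fc).
    apply: contra_neq p0 => c0; move/eqP: Ec; rewrite c0 expr0n /= /u mulf_eq0 oppr_eq0.
    by rewrite sqrf_eq0 (negPf qv0) invr_eq0 => /eqP.
  by rewrite -Ec /u; field.
- exfalso; have Eqv := conjqv _ E (expr1n _ 2); rewrite mul1r in Eqv.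
  move/eqP: Eqv; apply/negP; apply: assoc_not_real => //.
    by rewrite exprMn mulrAC rpredM // rpredX.
  have -> : p / (q * v) ^+ 2 = p / q ^+ 2 * v^-1 ^+ 2 by field; rewrite q0 v0.
  by rewrite rpredM // rpredX.
Qed.

Lemma integers_adjoin : same_set L K \/ same_set L (Fsqrt s) ->
  (forall x, O x -> pideal (ring_of_integers L) q x -> pideal O p x) ->
  same_set (ring_of_integers L) (adjoin O q).
Proof.
move=> cl qO; have [Lw Aw ww] := conj_quotient; have [a [N oN wN]] := conj_quotient_root.
have w2 : w ^+ (2 ^ a) = 1.
  by apply: (odd_root_of_unity_trivial cl _ oN); [exact: subringX | rewrite -exprM].
have Ac x : x \in Aint -> x^* \in Aint by rewrite (Aint_aut Num.conj).
have w0 : w != 0 by rewrite mulf_neq0 ?invr_eq0.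
have wV : w^-1 \in Aint.
  by rewrite (_ : w^-1 = w^*) ?Ac //; apply: (mulfI w0); rewrite ww divff.
have nrq := assoc_not_real Lq Aq q0 Aqp Apq.
have w1 : w != 1.
  by apply: contra_neq nrq => E; rewrite -[q^*](divfK q0) E mul1r.
have A2w := pow2_root_of_unity_dvd2 Aw w1 w2.
have Lqc := cm_conj Lq; have Op := Ounder_pgen s.
have [u Ou D2] := pgen_dvd2 hs; have [u' Ou' D2'] := pgenX_dvd2 hs.
have Lp : L p by exact: FL.
pose T := q + q^*.
have OT : O T.
  apply: (ring_of_integers_Ffield hs); last by rewrite rpredD ?Ac.
  by apply: cm_real; [exact: subringD | rewrite rmorphD /= conjCK addrC].
(* The trace [T = q (1 + w)] lies both in O and in the ideal of [q], so [p] divides it. *)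
have [r [Or ET]] : pideal O p T.
  apply: qO => //; exists (1 + w); split; last by rewrite /T mulrDl mul1r divfK.
  by split; [apply: subringD => //; exact: subring1 | rewrite rpredD ?rpred1].
pose eps := p / (q * q^*).
have Eeps : eps = p / q ^+ 2 * w^-1 by rewrite /eps; field; rewrite q0 qc0.
have EepsV : eps^-1 = q ^+ 2 / p * w by rewrite /eps; field; rewrite q0 p0 qc0.
have Feps : F eps.
  apply: cm_real; first by apply: subfield_div => //; exact: subringM.
  by rewrite /eps rmorphM fmorphV rmorphM /= conjCK pc (mulrC q).
have Oeps : O eps by apply: (ring_of_integers_Ffield hs); rewrite // Eeps rpredM.
have OepsV : O eps^-1.
  by apply: (ring_of_integers_Ffield hs); [exact: Ffield_inv | rewrite EepsV rpredM].
have hA : is_subring (adjoin O q) by exact: adjoin_subring.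
have AO x : O x -> adjoin O q x by exact: adjoin_const.
have Aqq : adjoin O q q by exact: adjoin_gen.
have AintA x : adjoin O q x -> x \in Aint.
  by apply: (sub_adjoin Aint_subringP) => // y; exact: Ounder_Aint.
(* [q] is a root of [X^2 - T X + q q^*], with [T] in [(p)] and [q q^*] a generator of [(p)]. *)
have [rho Arho Eq2] : exists2 rho, adjoin O q rho & q ^+ 2 = p * rho.
  exists (r * q - eps^-1).
    by apply: subringB => //; [apply: subringM => //|]; exact: AO.
  have -> : p * (r * q - eps^-1) = (r * p) * q - p / eps by ring.
  by rewrite -ET /T /eps; field; rewrite p0 q0 qc0.
have [pi Api Epi] : exists2 pi, adjoin O q pi & p = q * pi.
  exists ((T - q) * eps); last by rewrite /T /eps; field; rewrite q0 qc0.
  by apply: subringM => //; [apply: subringB => //|]; exact: AO.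
move=> x; split; last first.
  move=> Ax; split; last exact: AintA.
  by apply: sub_adjoin Ax => // y /(Ounder_Ffield)/FL.
move=> [Lx Ax]; have Lxc := cm_conj Lx.
(* Here [k = 2 m] since [p] divides [q ^+ 2] and 2 divides [p ^+ m]; [N = 2] matches the denominator
   4 of the coordinates of [x] below. *)
apply: (integral_descent (p := q) (k := (2 * m)%N) (N := 2) hA) => //.
- by exists (pi * u); [apply: subringM => //; exact: AO | rewrite mulrA -Epi].
- exists (u' * rho ^+ m).
    by apply: subringM => //; [exact: AO | exact: subringX].
  by rewrite exprM Eq2 exprMn D2' mulrA.
- move=> y; apply: (sub_adjoin (S := fun x =>
    exists2 c : int, True & exists2 t, adjoin O q t & x = c%:~R + q * t)).
  + exact: residue_subring.
  + move=> c /Ounder_mod_pgen[e _ [t Ot ->]]; exists e => //; exists (pi * t).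
      by apply: subringM => //; exact: AO.
    by rewrite mulrA -Epi.
  + by exists 0 => //; exists 1; [exact: subring1 | rewrite add0r mulr1].
have nzq : q - q^* != 0 by rewrite subr_eq0 eq_sym.
pose b := (x - x^*) / (q - q^*).
have Fb : F b.
  apply: cm_real; first by apply: subfield_div; exact: subringB.
  by rewrite /b rmorphM fmorphV !rmorphB /= !conjCK -(opprB x) -(opprB q) invrN mulrNN.
have Fa : F (x - b * q).
  have Lb : L b by exact: FL.
  apply: cm_real; first by apply: subringB => //; exact: subringM.
  rewrite rmorphB rmorphM /= (Ffield_conj hs Fb) /b; field; exact: nzq.
have F4 : F (2 ^+ 2) by apply: subringX => //; exact: (subring_nat hF 2).
have A4 : 2 ^+ 2 \in Aint by rewrite rpredX // Aint_Cnat ?natr_nat.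
have Ob : O (2 ^+ 2 * b).
  apply: (ring_of_integers_Ffield hs); first exact: subringM.
  have E1 : q - q^* = q * (1 - w) by field.
  (* One factor 2 absorbs [1 - w]; the other is [u p], and [p / q] is the integral element
     [p / q ^+ 2] times [q]. *)
  have -> : 2 ^+ 2 * b = (x - x^*) * (2 / (1 - w)) * (u * (p / q ^+ 2) * q).
    rewrite {1}expr2 {2}D2 /b E1; field; by rewrite q0 nzq.
  have B1 : (x - x^*) * (2 / (1 - w)) \in Aint by rewrite rpredM // rpredB ?Ac.
  have B2 : u * (p / q ^+ 2) \in Aint by rewrite rpredM // (Ounder_Aint hs).
  by rewrite rpredM // rpredM.
have Oa : O (2 ^+ 2 * (x - b * q)).
  apply: (ring_of_integers_Ffield hs); first exact: subringM.
  have Ab := Ounder_Aint hs Ob; rewrite mulrBr mulrA rpredB //; first by rewrite rpredM.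
  by rewrite rpredM.
have -> : 2 ^+ 2 * x = 2 ^+ 2 * (x - b * q) + 2 ^+ 2 * b * q by ring.
by apply: subringD => //; [exact: AO | apply: subringM => //; exact: AO].
Qed.

End AssociateSquare.
End Quadratic.

(** * From conditions on ideals to divisibility of elements *)

Theorem theorem4p22 (s : nat) (hs : (3 <= s)%N) (L : algC -> Prop) :
  is_subfield L ->
  subset_of (Ffield s) L ->
  degree2_over (Ffield s) L ->
  totally_complex L ->
  (exists q, ring_of_integers L q /\
     same_set (pideal (ring_of_integers L) (pgen s))
              (pideal (ring_of_integers L) (q ^+ 2))) ->
  (same_set L (Kfield s) \/ same_set L (Fsqrt s)) /\
  (forall q, ring_of_integers L q ->
     prime_ideal (ring_of_integers L) (pideal (ring_of_integers L) q) ->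
     same_set (fun x => pideal (ring_of_integers L) q x /\ Ounder s x)
              (pideal (Ounder s) (pgen s)) ->
     same_set (ring_of_integers L) (adjoin (Ounder s) q)).
Proof.
move=> hL FL h2 tc [q1 [[Lq1 Aq1] Eq1]].
have [d [Ld dc spand]] := quadratic_imaginary_generator hs hL FL h2 tc.
have hLr := subfield_subring hL; have hO := Ounder_subring s.
have p0 := pgen_neq0 hs.
have I1 : ring_of_integers L 1 by split; [exact: subring1 | rewrite rpred1].
have [r [[Lr Ar] Er]] : pideal (ring_of_integers L) (q1 ^+ 2) (pgen s).
  by apply/Eq1; exists 1; rewrite mul1r.
have [r' [[Lr' Ar'] Er']] : pideal (ring_of_integers L) (pgen s) (q1 ^+ 2).
  by apply/Eq1; exists 1; rewrite mul1r.
have q10 : q1 != 0 by apply: contra_neq p0 => E; rewrite Er E expr0n mulr0.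
have Aqp : q1 ^+ 2 / pgen s \in Aint by rewrite Er' mulfK.
have Apq : pgen s / q1 ^+ 2 \in Aint by rewrite Er mulfK // expf_neq0.
have cl := cm_classification hs hL FL Ld dc spand Lq1 Aq1 q10 Aqp Apq.
split=> // q [Lq Aq] [_ primeq] capq.
have conjL := cm_conj hs hL FL Ld dc spand.
have Ac x : x \in Aint -> x^* \in Aint by rewrite (Aint_aut Num.conj).
have [r2 [[Lr2 Ar2] Er2]] : pideal (ring_of_integers L) q (pgen s).
  have [] // := (capq (pgen s)).2; exists 1; rewrite mul1r; split=> //; exact: subring1.
(* The prime ideal of [q] contains [p], hence [q1 ^+ 2], hence [q1]. *)
have [t [[Lt At] Et]] : pideal (ring_of_integers L) q q1.
  have [] // := primeq q1 q1 (conj Lq1 Aq1) (conj Lq1 Aq1).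
  exists (r' * r2); split; last by rewrite -mulrA -Er2 -Er' expr2.
  by split; [exact: subringM | rewrite rpredM].
have q0 : q != 0 by apply: contra_neq q10 => E; rewrite Et E mulr0.
have t0 : t != 0 by apply: contra_neq q10 => E; rewrite Et E mul0r.
have Oqq : Ounder s (q * q^*).
  apply: (ring_of_integers_Ffield hs); last by rewrite rpredM ?Ac.
  apply: (cm_real hs dc spand); first by apply: subringM => //; exact: conjL.
  by rewrite rmorphM /= conjCK mulrC.
have [c [Oc Ec]] : pideal (Ounder s) (pgen s) (q * q^*).
  apply/capq; split=> //; exists q^*; rewrite mulrC; split=> //.
  by split; [exact: conjL | exact: Ac].
(* Taking norms in [q1 = t * q] shows that [t] is a unit. *)
have pc : (pgen s)^* = pgen s by apply/(Ffield_conj hs)/pgen_Ffield.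
have rr : r * r' = 1.
  by apply: (mulIf p0); rewrite mul1r -mulrA -Er' -Er.
have AtV : t^-1 \in Aint.
  (* The right-hand side is a unit, as [r r' = 1], and the left-hand side is a multiple of [t]. *)
  have Ett : (t * t^* * c) ^+ 2 = r' * r'^*.
    have p20 : pgen s ^+ 2 != 0 by rewrite expf_neq0.
    apply: (mulIf p20).
    have -> : (t * t^* * c) ^+ 2 * pgen s ^+ 2 = (t * t^* * (c * pgen s)) ^+ 2 by ring.
    rewrite -Ec.
    have -> : (t * t^* * (q * q^*)) ^+ 2 = (t * q) ^+ 2 * (t^* * q^*) ^+ 2 by ring.
    rewrite -rmorphM -rmorphXn /= -Et Er' rmorphM /= pc; ring.
  have rc : r^* * r'^* = 1 by rewrite -rmorphM rr rmorph1.
  have -> : t^-1 = t * (t^* * c) ^+ 2 * r * r^*.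
    apply: (mulfI t0); rewrite divff //.
    have -> : t * (t * (t^* * c) ^+ 2 * r * r^*) = (t * t^* * c) ^+ 2 * (r * r^*) by ring.
    rewrite Ett; have -> : r' * r'^* * (r * r^*) = (r * r') * (r^* * r'^*) by ring.
    by rewrite rr rc mulr1.
  have Acc := Ounder_Aint hs Oc.
  by rewrite !rpredM ?rpredX ?rpredM ?Ac.
have Eq : q = q1 / t by rewrite Et mulrAC divff ?mul1r.
apply: (integers_adjoin hs hL FL Ld dc spand Lq Aq q0 _ _ cl) => [||x Ox qx].
- have -> : q ^+ 2 / pgen s = q1 ^+ 2 / pgen s * t^-1 ^+ 2 by rewrite Eq; field; rewrite p0 t0.
  by rewrite rpredM // rpredX.
- have -> : pgen s / q ^+ 2 = pgen s / q1 ^+ 2 * t ^+ 2 by rewrite Eq; field; rewrite q10 t0.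
  by rewrite rpredM // rpredX.
- by apply/capq.
Qed.
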